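(* Let $f\in C^0(\overline{H^2})\cap C^\infty(H^2)$ satisfy $f\ge 0$ and $$f_{xx}+f_{yy}+\frac{3}{x}f_x=0\quad\text{on } H^2 .$$ Then $f$ is constant.
   Context: $H^2=\{(x,y)\in\mathbb{R}^2: x>0\}$ denotes the open right half-plane and $\overline{H^2}=\{x\ge 0\}$ its closure. *)

(* Defs.v *)
From Stdlib Require Import Reals.
Open Scope R_scope.

Definition H2 (x y : R) : Prop := 0 < x.
Definition H2bar (x y : R) : Prop := 0 <= x.

Definition cont_at_in (D : R -> R -> Prop) (f : R -> R -> R) (x0 y0 : R) : Prop :=
  forall eps, 0 < eps -> exists delta, 0 < delta /\
    forall x y, D x y -> Rabs (x - x0) < delta -> Rabs (y - y0) < delta ->
      Rabs (f x y - f x0 y0) < eps.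

Definition C0_on (D : R -> R -> Prop) (f : R -> R -> R) : Prop :=
  forall x y, D x y -> cont_at_in D f x y.

Definition is_dx (f : R -> R -> R) (x y l : R) : Prop :=
  derivable_pt_lim (fun t => f t y) x l.
Definition is_dy (f : R -> R -> R) (x y l : R) : Prop :=
  derivable_pt_lim (fun t => f x t) y l.

Fixpoint Ck_H2 (k : nat) (f : R -> R -> R) : Prop :=
  C0_on H2 f /\
  match k with
  | O => True
  | S k' => exists fx fy : R -> R -> R,
      (forall x y, H2 x y -> is_dx f x y (fx x y) /\ is_dy f x y (fy x y)) /\
      Ck_H2 k' fx /\ Ck_H2 k' fy
  end.

Definition Cinf_H2 (f : R -> R -> R) : Prop := forall k, Ck_H2 k f.

(* Main.v *)
Require Import Defs.
From Stdlib Require Import Reals Lra Lia Psatz.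
From Coquelicot Require Import Coquelicot.
Open Scope R_scope.

(** In the coordinates [x = e^s sin t], [y = e^s cos t] the equation becomes
    [F_ss + 3 F_s + F_tt + 3 cot t F_t = 0] on [0 < t < PI]. Its moments
    [m_n(s) = int_0^PI F(s, t) sin^3 t cos^n t dt] then satisfy
    [m_n'' + 3 m_n' - n (n + 3) m_n = - n (n - 1) m_(n-2)]; the degenerate
    endpoints are handled by cutting off at [sin t = eps], which costs an error
    [O(eps)]. Since [f] is continuous at the origin, [m_0] is bounded at [-oo],
    hence constant. Positivity gives [|m_n| <= m_0], so all [m_n] are bounded
    and, by induction on [n], constant. The moments determine [F(s, .)], so [F]
    does not depend on [s], and letting [s] tend to [-oo] gives [f = f(0, 0)]. *)

(** The equation is Laplace's equation on R^5 for functions of [x = |z|], z in R^4, and [y]. Up to a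
    constant, [sin^3 t dt] is the surface measure of the 4-sphere, and it puts the angular part into
    the symmetric form [sin^-3 (sin^3 F_t)_t]. The obstacle is the axis [x = 0]: nothing is known
    there about the derivatives of [f], so the moments cannot be differentiated directly, nor can
    one integrate by parts up to [t = 0] and [t = PI]. The axis has codimension 4, and [1 / r^2] is
    harmonic on R^4 minus a point; this is the origin of the cutoff [1 - eps^2 / sin^2 t]. Its
    derivative times [sin^3 t] is [2 eps^2 cos t], so the angular operator leaves no singular term.
    The moment equation is obtained only up to small errors, which a maximum principle tolerates.
    For [n > 0] the homogeneous solutions are [e^(n s)] and [e^(-(n+3) s)], one unbounded at each
    end, so a solution bounded on the whole line is constant. Continuity of [f] gives no bound as
    [s] tends to [+oo]; that bound is what nonnegativity supplies, through the constancy of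
    [m_0]. *)

Lemma continuity_pt_of_is_derive (f : R -> R) (x l : R) :
  is_derive f x l -> continuity_pt f x.
Proof.
  intros H. apply continuity_pt_filterlim. apply (ex_derive_continuous f x).
  now exists l.
Qed.

(** * Maximum principle and bounded approximate solutions of [m'' + 3 m' - k m = h] *)

Lemma interior_maximum_derivatives (v v1 v2 : R -> R) (A B c : R) :
  (forall s, is_derive v s (v1 s)) -> (forall s, is_derive v1 s (v2 s)) ->
  A < c < B -> (forall s, A <= s <= B -> v s <= v c) ->
  v1 c = 0 /\ v2 c <= 0.
Proof.
  intros H1 H2 Hc Hmax.
  assert (E : v1 c = 0).
  { assert (D : derivable_pt_lim v c (v1 c)) by now apply is_derive_Reals.
    assert (M := deriv_maximum v A B c (exist _ _ D) (proj1 Hc) (proj2 Hc)).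
    rewrite <- M; [reflexivity | intros; apply Hmax; lra]. }
  split; [exact E|].
  destruct (Rle_or_lt (v2 c) 0) as [|Hp]; [assumption|exfalso].
  assert (D := H2 c). apply is_derive_Reals in D.
  destruct (D (v2 c) Hp) as [d Hd].
  set (h := Rmin (d / 2) ((B - c) / 2)).
  assert (d0 := cond_pos d).
  assert (Hh : 0 < h) by (unfold h; apply Rmin_pos; lra).
  assert (h <= d / 2) by apply Rmin_l. assert (h <= (B - c) / 2) by apply Rmin_r.
  assert (pos : forall s, c < s <= c + h -> 0 < v1 s).
  { intros s Hs. specialize (Hd (s - c)).
    replace (c + (s - c)) with s in Hd by ring. rewrite E in Hd.
    assert (Hd' := Hd ltac:(lra) ltac:(rewrite Rabs_pos_eq; lra)).
    apply Rabs_def2 in Hd'. destruct Hd' as [_ Hd'].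
    assert (0 < (v1 s - 0) / (s - c)) by lra.
    replace (v1 s) with ((v1 s - 0) / (s - c) * (s - c)) by (field; lra).
    apply Rmult_lt_0_compat; lra. }
  destruct (MVT_cor2 v v1 c (c + h)) as [x [Hx1 Hx2]]; [lra| |].
  { intros; now apply is_derive_Reals. }
  assert (0 < v1 x * (c + h - c)).
  { apply Rmult_lt_0_compat; [apply pos; lra | lra]. }
  assert (v (c + h) <= v c) by (apply Hmax; lra). lra.
Qed.

(** At a positive interior maximum [v1] vanishes, [v2 <= 0] and [- k * v <= 0], against the strict
    inequality. The case [k = 0] is included, since it governs the moment of order 0. *)
Lemma max_principle (v v1 v2 : R -> R) (A B k : R) :
  0 <= k ->
  (forall s, is_derive v s (v1 s)) -> (forall s, is_derive v1 s (v2 s)) ->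
  (forall s, A <= s <= B -> 0 < v2 s + 3 * v1 s - k * v s) ->
  v A <= 0 -> v B <= 0 -> forall s, A <= s <= B -> v s <= 0.
Proof.
  intros Hk H1 H2 L HA HB s Hs.
  destruct (continuity_ab_maj v A B) as [c [Hc1 Hc2]]; [lra| |].
  { intros; eapply continuity_pt_of_is_derive; apply H1. }
  destruct (Rle_or_lt (v c) 0) as [|Hp]; [specialize (Hc1 s Hs); lra|exfalso].
  assert (c <> A) by (intros ->; lra). assert (c <> B) by (intros ->; lra).
  destruct (interior_maximum_derivatives v v1 v2 A B c) as [E1 E2];
    auto; [lra|].
  specialize (L c Hc2). rewrite E1 in L.
  assert (0 <= k * v c) by (apply Rmult_le_pos; lra). lra.
Qed.

(* [m] solves [m'' + 3 m' - k m = h] as a locally uniform limit of functions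
   that solve it up to small errors. *)
Definition approx_solution (k h : R) (m : R -> R) : Prop :=
  forall A B delta, A < B -> 0 < delta -> exists u u1 u2 : R -> R,
    (forall s, is_derive u s (u1 s)) /\ (forall s, is_derive u1 s (u2 s)) /\
    forall s, A <= s <= B ->
      Rabs (u s - m s) <= delta /\
      Rabs (u2 s + 3 * u1 s - k * u s - h) <= delta.

Lemma approx_solution_opp (k h : R) (m : R -> R) :
  approx_solution k h m -> approx_solution k (- h) (fun s => - m s).
Proof.
  intros H A B delta HAB Hd.
  destruct (H A B delta HAB Hd) as [u [u1 [u2 [H1 [H2 H3]]]]].
  exists (fun s => - u s), (fun s => - u1 s), (fun s => - u2 s).
  split; [|split; [|intros s Hs; split]]; intros.
  - apply (is_derive_opp u s (u1 s)), H1.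
  - apply (is_derive_opp u1 s (u2 s)), H2.
  - replace (- u s - - m s) with (- (u s - m s)) by ring.
    rewrite Rabs_Ropp. now apply H3.
  - replace (_ - _) with (- (u2 s + 3 * u1 s - k * u s - h)) by ring.
    rewrite Rabs_Ropp. now apply H3.
Qed.

(** Comparison with an exact solution [P]. A smooth approximant [u] satisfies the equation only up
    to [d], so [u - P] is tilted by a small affine function to make the differential inequality
    strict. *)
Lemma approx_solution_le (k h : R) (m P P1 P2 : R -> R) (A B : R) :
  0 <= k -> approx_solution k h m ->
  (forall s, is_derive P s (P1 s)) -> (forall s, is_derive P1 s (P2 s)) ->
  (forall s, P2 s + 3 * P1 s - k * P s = h) ->
  A < B -> m A <= P A -> m B <= P B ->
  forall s, A <= s <= B -> m s <= P s.
Proof.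
  intros Hk Hm HP1 HP2 HP HAB HA HB s Hs.
  apply le_epsilon. intros eps Heps.
  (* The tilt [- d - d * (B - s)] adds at least [3 * d] to the operator, more than the error [d].
     The total loss is [d] from [u] against [m], plus at most [d + d * (B - A)] from the tilt:
     exactly [eps]. *)
  set (d := eps / (2 + (B - A))).
  assert (Hd : 0 < d) by (apply Rdiv_lt_0_compat; lra).
  destruct (Hm A B d HAB Hd) as [u [u1 [u2 [Hu1 [Hu2 Hu]]]]].
  assert (V := max_principle (fun s => (u s - P s) + (- d - d * (B - s)))
    (fun s => u1 s - P1 s + d) (fun s => u2 s - P2 s) A B k Hk).
  assert (V' : (u s - P s) + (- d - d * (B - s)) <= 0).
  { apply V; auto.
    - intros t. apply (is_derive_plus (fun s => u s - P s)
        (fun s => - d - d * (B - s)) t (u1 t - P1 t) d).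
      + apply (is_derive_minus u P); auto.
      + auto_derive; auto; ring.
    - intros t. rewrite <- (Rplus_0_r (u2 t - P2 t)).
      apply (is_derive_plus (fun s => u1 s - P1 s) (fun s => d)
        t (u2 t - P2 t) 0).
      + apply (is_derive_minus u1 P1); auto.
      + auto_derive; auto.
    - intros t Ht. destruct (Hu t Ht) as [_ E].
      apply Rabs_le_between in E. specialize (HP t).
      assert (0 <= k * (d + d * (B - t))) by
        (apply Rmult_le_pos; [|assert (0 <= d * (B - t)) by (apply Rmult_le_pos; lra)]; lra).
      nra.
    - destruct (Hu A) as [E _]; [lra|]. apply Rabs_le_between in E.
      assert (0 <= d * (B - A)) by (apply Rmult_le_pos; lra). lra.
    - destruct (Hu B) as [E _]; [lra|]. apply Rabs_le_between in E. lra. }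
  destruct (Hu s Hs) as [E _]. apply Rabs_le_between in E.
  assert (d * (B - s) <= d * (B - A)) by (apply Rmult_le_compat_l; lra).
  assert (d * (2 + (B - A)) = eps) by (unfold d; field; lra). lra.
Qed.

Lemma exp_neg_small (M eps : R) :
  0 <= M -> 0 < eps -> exists T, 0 < T /\ forall x, T <= x -> M * exp (- x) <= eps.
Proof.
  intros HM He. exists (M / eps + 1). split.
  - assert (0 <= M / eps) by (apply Rdiv_le_0_compat; lra). lra.
  - intros x Hx. rewrite exp_Ropp.
    assert (0 <= M / eps) by (apply Rdiv_le_0_compat; lra).
    assert (1 + x < exp x) by (apply exp_ineq1; lra).
    apply Rle_div_l; [apply exp_pos|].
    assert (M / eps <= exp x) by lra.
    replace M with (eps * (M / eps)) by (field; lra). nra.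
Qed.

(** The barrier is the constant solution [- h / k] plus multiples of the two homogeneous
    exponentials, each normalized to 1 at one end of an interval centred at [s]. It dominates [m] at
    both ends, and at the centre the exponentials die out as the interval grows. *)
Lemma approx_solution_bounded_le (n h M : R) (m : R -> R) :
  0 < n -> approx_solution (n * (n + 3)) h m ->
  (forall s, Rabs (m s) <= M) ->
  forall s, m s <= - h / (n * (n + 3)).
Proof.
  intros Hn Hm HM s. set (k := n * (n + 3)) in *.
  assert (Hk : 0 < k) by (apply Rmult_lt_0_compat; lra).
  set (M' := M + Rabs (h / k)).
  assert (HM' : 0 <= M') by
    (unfold M'; assert (H0 := HM 0); assert (H1 := Rabs_pos (m 0));
     assert (H2 := Rabs_pos (h / k)); lra).
  apply le_epsilon. intros eps He.
  destruct (exp_neg_small (2 * M') eps ltac:(lra) He) as [T0 [HT0 HT]].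
  (* The slower of the decay rates [n] and [n + 3] fixes the half-length: both exponents at the
     centre are at most [- T0]. *)
  set (T := T0 / n).
  assert (nT : n * T = T0) by (unfold T; field; lra).
  assert (HTp : 0 < T) by (apply Rdiv_lt_0_compat; lra).
  set (B := s + T). set (A := s - T).
  assert (Hb : forall t, m t <= - h / k + M').
  { intros t. specialize (HM t). unfold M'.
    apply Rabs_le_between in HM.
    assert (H0 := Rle_abs (h / k)). unfold Rdiv in *. lra. }
  assert (E := approx_solution_le k h m
    (fun t => - h / k + M' * (exp (n * (t - B)) + exp (- (n + 3) * (t - A))))
    (fun t => M' * (n * exp (n * (t - B)) - (n + 3) * exp (- (n + 3) * (t - A))))
    (fun t => M' * (n ^ 2 * exp (n * (t - B)) + (n + 3) ^ 2 * exp (- (n + 3) * (t - A))))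
    A B ltac:(lra) Hm).
  assert (F : m s <= - h / k + M' * (exp (n * (s - B)) + exp (- (n + 3) * (s - A)))).
  { apply E; unfold A, B in *; try lra.
    - intros t. auto_derive; auto; unfold Rminus; ring.
    - intros t. auto_derive; auto; unfold Rminus; ring.
    - intros t. unfold k. field. split; lra.
    - specialize (Hb (s - T)).
      replace (- (n + 3) * (s - T - (s - T))) with 0 by ring. rewrite exp_0.
      assert (0 <= M' * exp (n * (s - T - (s + T)))) by
        (apply Rmult_le_pos; [lra | left; apply exp_pos]). lra.
    - specialize (Hb (s + T)).
      replace (n * (s + T - (s + T))) with 0 by ring. rewrite exp_0.
      assert (0 <= M' * exp (- (n + 3) * (s + T - (s - T)))) by
        (apply Rmult_le_pos; [lra | left; apply exp_pos]). lra. }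
  assert (G1 := HT T0 (Rle_refl _)).
  assert (G2 := HT ((n + 3) * T) ltac:(lra)).
  replace (n * (s - B)) with (- T0) in F by (unfold B; lra).
  replace (- (n + 3) * (s - A)) with (- ((n + 3) * T)) in F by (unfold A; ring).
  lra.
Qed.

Lemma approx_solution_bounded (n h M : R) (m : R -> R) :
  0 < n -> approx_solution (n * (n + 3)) h m ->
  (forall s, Rabs (m s) <= M) ->
  forall s, m s = - h / (n * (n + 3)).
Proof.
  intros Hn Hm HM s. apply Rle_antisym.
  - now apply approx_solution_bounded_le with (M := M).
  - assert (H := approx_solution_bounded_le n (- h) M (fun s => - m s) Hn
      (approx_solution_opp _ _ _ Hm)).
    assert (H' := H ltac:(intros; cbv beta; rewrite Rabs_Ropp; auto) s). simpl in H'.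
    replace (- - h / (n * (n + 3))) with (- (- h / (n * (n + 3)))) in H'
      by (unfold Rdiv; ring). lra.
Qed.

(* The solutions of [m'' + 3 m' = 0] are [a + b e^(-3 s)], and boundedness at
   [-oo] excludes the second term. *)
Lemma approx_solution0_le (m : R -> R) (B M : R) :
  approx_solution 0 0 m -> (forall s, s <= B -> Rabs (m s) <= M) ->
  forall s, s < B -> m s <= m B.
Proof.
  intros Hm HM s Hs. apply le_epsilon. intros eps He.
  assert (HMB := HM B (Rle_refl _)). assert (H0 := Rabs_pos (m B)).
  destruct (exp_neg_small (2 * M) eps ltac:(lra) He) as [T [HT0 HT]].
  set (A := s - T).
  (* The constant [m B] already matches [m] at the right end, so only the left end needs an
     exponential; there the barrier is [m B + 2 * M >= M]. It has decayed at [s] once the left end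
     is far away. *)
  assert (E := approx_solution_le 0 0 m
    (fun t => m B + 2 * M * exp (- 3 * (t - A)))
    (fun t => - 3 * (2 * M) * exp (- 3 * (t - A)))
    (fun t => 9 * (2 * M) * exp (- 3 * (t - A)))
    A B ltac:(lra) Hm).
  assert (F : m s <= m B + 2 * M * exp (- 3 * (s - A))).
  { apply E; unfold A in *; try lra.
    - intros t. auto_derive; auto; unfold Rminus; ring.
    - intros t. auto_derive; auto; unfold Rminus; ring.
    - intros t. ring.
    - replace (- 3 * (s - T - (s - T))) with 0 by ring. rewrite exp_0.
      assert (H1 := HM (s - T) ltac:(lra)).
      apply Rabs_le_between in H1. apply Rabs_le_between in HMB. lra.
    - assert (0 <= 2 * M * exp (- 3 * (B - (s - T)))) by
        (apply Rmult_le_pos; [lra | left; apply exp_pos]). lra. }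
  assert (G := HT (3 * T) ltac:(lra)).
  replace (- 3 * (s - A)) with (- (3 * T)) in F by (unfold A; ring). lra.
Qed.

Lemma approx_solution0_const (m : R -> R) :
  approx_solution 0 0 m ->
  (forall B, exists M, forall s, s <= B -> Rabs (m s) <= M) ->
  forall s t, m s = m t.
Proof.
  intros Hm HM.
  assert (L : forall s t, s < t -> m s = m t).
  { intros s t Hst. destruct (HM t) as [M HMt]. apply Rle_antisym.
    - now apply approx_solution0_le with (M := M).
    - assert (Hm' := approx_solution_opp _ _ _ Hm). rewrite Ropp_0 in Hm'.
      assert (H := approx_solution0_le _ t M Hm').
      cut (- m s <= - m t); [lra|]. apply H; [|exact Hst].
      intros; cbv beta; rewrite Rabs_Ropp; auto. }
  intros s t. destruct (Rtotal_order s t) as [H|[->|H]]; auto.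
  symmetry; auto.
Qed.

(** * Differentiation under the integral and the weak form of the polar equation *)

Lemma ex_RInt_continuity_pt (f : R -> R) (a b : R) :
  a <= b -> (forall t, a <= t <= b -> continuity_pt f t) -> ex_RInt f a b.
Proof.
  intros Hab H. apply (ex_RInt_continuous (V := R_CompleteNormedModule)).
  rewrite Rmin_left, Rmax_right by lra.
  intros t Ht. now apply continuity_pt_filterlim, H.
Qed.

Lemma continuity_2d_pt_slice (F : R -> R -> R) (s t : R) :
  continuity_2d_pt F s t -> continuity_pt (F s) t.
Proof.
  intros H eps He. destruct (H (mkposreal eps He)) as [d Hd].
  exists d. split; [apply cond_pos|]. intros x [_ Hx].
  apply Hd; [rewrite Rminus_diag, Rabs_R0; apply cond_pos | exact Hx].
Qed.

(** The strict margins [l < a] and [b < r] matter: the derivative in [s] must be known, and jointly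
    continuous, on a full neighbourhood of each [t] in [[a, b]], endpoints included. *)
Lemma is_derive_RInt_weighted (G Gs : R -> R -> R) (w : R -> R) (l r a b s : R) :
  l < a -> a <= b -> b < r ->
  (forall s t, l < t < r -> is_derive (fun z => G z t) s (Gs s t)) ->
  (forall s t, l < t < r -> continuity_2d_pt G s t) ->
  (forall s t, l < t < r -> continuity_2d_pt Gs s t) ->
  (forall t, a <= t <= b -> continuity_pt w t) ->
  is_derive (fun s => RInt (fun t => G s t * w t) a b) s
    (RInt (fun t => Gs s t * w t) a b).
Proof.
  intros Hl Hab Hr HD HC HCs Hw.
  assert (Hder : forall s t, l < t < r ->
    is_derive (fun z => G z t * w t) s (Gs s t * w t)).
  { intros z t Ht. evar_last.
    - apply (is_derive_scal_l (fun z => G z t) z (Gs z t) (w t)). now apply HD.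
    - reflexivity. }
  evar_last.
  - apply (is_derive_RInt_param (fun s t => G s t * w t)).
    + apply filter_forall. intros z t Ht.
      rewrite Rmin_left, Rmax_right in Ht by lra.
      exists (Gs z t * w t). apply Hder. lra.
    + rewrite Rmin_left, Rmax_right by lra. intros t Ht.
      apply continuity_2d_pt_ext_loc with (fun u v => Gs u v * w v).
      { assert (Hm : 0 < Rmin (t - l) (r - t)) by (apply Rmin_pos; lra).
        exists (mkposreal _ Hm). simpl. intros u v _ Hv.
        assert (H1 := Rmin_l (t - l) (r - t)).
        assert (H2 := Rmin_r (t - l) (r - t)).
        apply Rabs_def2 in Hv.
        symmetry. apply is_derive_unique, Hder. lra. }
      apply continuity_2d_pt_mult; [apply HCs; lra|].
      apply (continuity_1d_2d_pt_comp w (fun _ v => v)); [now apply Hw|].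
      apply continuity_2d_pt_id2.
    + apply filter_forall. intros z. apply ex_RInt_continuity_pt; auto.
      intros t Ht. apply continuity_pt_mult; [|now apply Hw].
      apply continuity_2d_pt_slice, HC. lra.
  - apply RInt_ext. rewrite Rmin_left, Rmax_right by lra.
    intros t Ht. apply is_derive_unique, Hder. lra.
Qed.

(* [F s t] stands for [f (e^s sin t) (e^s cos t)]. *)
Definition polar_solution (F Fs Ft Fss Ftt : R -> R -> R) : Prop :=
  forall s t, 0 < t < PI ->
    is_derive (fun z => F z t) s (Fs s t) /\
    is_derive (fun z => Fs z t) s (Fss s t) /\
    is_derive (F s) t (Ft s t) /\ is_derive (Ft s) t (Ftt s t) /\
    continuity_2d_pt F s t /\ continuity_2d_pt Fs s t /\
    continuity_2d_pt Fss s t /\ continuity_2d_pt Ftt s t /\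
    sin t * (Fss s t + 3 * Fs s t + Ftt s t) + 3 * cos t * Ft s t = 0.

(** Green's identity: after multiplication by [sin^2 t], the angular terms of the equation are
    [(sin^3 F_t)_t]. Two integrations by parts move both derivatives onto [g], and the boundary
    terms vanish with [g] and [g1]. *)
Lemma polar_solution_weak (F Fs Ft Fss Ftt : R -> R -> R) (g g1 g2 : R -> R)
    (a b s : R) :
  polar_solution F Fs Ft Fss Ftt -> 0 < a -> a <= b -> b < PI ->
  (forall t, a <= t <= b -> is_derive g t (g1 t)) ->
  (forall t, a <= t <= b -> is_derive g1 t (g2 t)) ->
  (forall t, a <= t <= b -> continuity_pt g2 t) ->
  g a = 0 -> g1 a = 0 -> g b = 0 -> g1 b = 0 ->
  RInt (fun t => Fss s t * (sin t ^ 3 * g t)) a b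
    + 3 * RInt (fun t => Fs s t * (sin t ^ 3 * g t)) a b
  = - RInt (fun t => F s t * (sin t ^ 3 * g2 t + 3 * sin t ^ 2 * cos t * g1 t)) a b.
Proof.
  intros HF Ha Hab Hb Hg Hg1 Hg2 ga g1a gb g1b.
  assert (Cs : forall t, continuity_pt sin t) by (intros; apply continuity_sin).
  assert (Cc : forall t, continuity_pt cos t) by (intros; apply continuity_cos).
  assert (Cg : forall t, a <= t <= b -> continuity_pt g t).
  { intros t Ht. eapply continuity_pt_of_is_derive. now apply Hg. }
  assert (Cg1 : forall t, a <= t <= b -> continuity_pt g1 t).
  { intros t Ht. eapply continuity_pt_of_is_derive. now apply Hg1. }
  assert (Cp : forall n t, continuity_pt (fun t => sin t ^ n) t).
  { intros n t. apply (continuity_pt_comp sin (fun x => x ^ n)); auto.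
    apply derivable_continuous_pt, derivable_pt_pow. }
  assert (I1 : ex_RInt (fun t => Fss s t * (sin t ^ 3 * g t)) a b).
  { apply ex_RInt_continuity_pt; auto. intros t Ht.
    destruct (HF s t ltac:(lra)) as [_ [_ [_ [_ [_ [_ [C _]]]]]]].
    apply continuity_pt_mult; [now apply continuity_2d_pt_slice|].
    apply continuity_pt_mult; auto. }
  assert (I2 : ex_RInt (fun t => Fs s t * (sin t ^ 3 * g t)) a b).
  { apply ex_RInt_continuity_pt; auto. intros t Ht.
    destruct (HF s t ltac:(lra)) as [_ [_ [_ [_ [_ [C _]]]]]].
    apply continuity_pt_mult; [now apply continuity_2d_pt_slice|].
    apply continuity_pt_mult; auto. }
  assert (I3 : ex_RInt (fun t => F s t *
    (sin t ^ 3 * g2 t + 3 * sin t ^ 2 * cos t * g1 t)) a b).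
  { apply ex_RInt_continuity_pt; auto. intros t Ht.
    destruct (HF s t ltac:(lra)) as [_ [_ [_ [_ [C _]]]]].
    apply continuity_pt_mult; [now apply continuity_2d_pt_slice|].
    apply continuity_pt_plus; apply continuity_pt_mult; auto.
    apply continuity_pt_mult; auto. apply continuity_pt_mult; auto.
    now apply continuity_pt_const. }
  (* [dphi] is the derivative of the boundary term [sin^3 (F_t g - F g1)]. Its integral is computed
     twice: 0 by the fundamental theorem, and the three integrals of the claim by the equation. *)
  set (dphi := fun t => 3 * sin t ^ 2 * cos t * (Ft s t * g t - F s t * g1 t)
    + sin t ^ 3 * (Ftt s t * g t - F s t * g2 t)).
  assert (J : is_RInt dphi a b 0).
  { evar_last.
    - apply (is_RInt_derive (fun t => sin t ^ 3 * (Ft s t * g t - F s t * g1 t))).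
      + rewrite Rmin_left, Rmax_right by lra. intros t Ht.
        destruct (HF s t ltac:(lra)) as [_ [_ [D1 [D2 _]]]].
        assert (E1 := Hg t Ht). assert (E2 := Hg1 t Ht).
        auto_derive.
        * repeat split; auto; eexists; eassumption.
        * rewrite (is_derive_unique (fun x : R => Ft s x) _ _ D2).
          rewrite (is_derive_unique (fun x : R => F s x) _ _ D1).
          rewrite (is_derive_unique (fun x : R => g x) _ _ E1).
          rewrite (is_derive_unique (fun x : R => g1 x) _ _ E2).
          unfold dphi. simpl. ring.
      + rewrite Rmin_left, Rmax_right by lra. intros t Ht.
        destruct (HF s t ltac:(lra)) as [_ [_ [D1 [D2 [C [_ [_ [C' _]]]]]]]].
        assert (CF : continuity_pt (F s) t) by now apply continuity_2d_pt_slice.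
        assert (CFt : continuity_pt (Ft s) t) by
          (eapply continuity_pt_of_is_derive; eassumption).
        assert (CFtt : continuity_pt (Ftt s) t) by now apply continuity_2d_pt_slice.
        apply continuity_pt_filterlim. unfold dphi.
        assert (K := continuity_pt_const (fun _ => 3) t (fun _ _ => eq_refl)).
        repeat first [assumption | now auto
          | apply continuity_pt_plus | apply continuity_pt_opp
          | apply continuity_pt_mult].
    - cbv beta. rewrite ga, gb, g1a, g1b. unfold minus, plus, opp. simpl. ring. }
  assert (K : is_RInt dphi a b (- (RInt (fun t => Fss s t * (sin t ^ 3 * g t)) a b
    + 3 * RInt (fun t => Fs s t * (sin t ^ 3 * g t)) a b
    + RInt (fun t => F s t * (sin t ^ 3 * g2 t + 3 * sin t ^ 2 * cos t * g1 t)) a b))).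
  { apply (RInt_correct (V := R_CompleteNormedModule)) in I1. apply (RInt_correct (V := R_CompleteNormedModule)) in I2. apply (RInt_correct (V := R_CompleteNormedModule)) in I3.
    assert (L := is_RInt_opp _ _ _ _ (is_RInt_plus _ _ _ _ _ _
      (is_RInt_plus _ _ _ _ _ _ I1 (is_RInt_scal _ _ _ 3 _ I2)) I3)).
    revert L. apply is_RInt_ext. rewrite Rmin_left, Rmax_right by lra.
    intros t Ht. destruct (HF s t ltac:(lra)) as [_ [_ [_ [_ [_ [_ [_ [_ E]]]]]]]].
    unfold dphi, opp, plus, scal. simpl. unfold mult. simpl.
    assert (E' : (sin t * (Fss s t + 3 * Fs s t + Ftt s t) + 3 * cos t * Ft s t)
      * (sin t ^ 2 * g t) = 0) by (rewrite E; ring).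
    simpl in E'. lra. }
  apply (is_RInt_unique (V := R_CompleteNormedModule)) in J. apply (is_RInt_unique (V := R_CompleteNormedModule)) in K.
  rewrite J in K. lra.
Qed.
(** By uniform continuity, [F] varies by less than 1 over each step shorter than [e], and one number
    [N] of steps reaches every point of the rectangle. *)
Lemma continuity_2d_bounded (F : R -> R -> R) (a b c d : R) :
  a <= b -> c <= d -> (forall s t, continuity_2d_pt F s t) ->
  exists K, forall s t, a <= s <= b -> c <= t <= d -> Rabs (F s t) <= K.
Proof.
  intros Hab Hcd HF.
  destruct (uniform_continuity_2d F a b c d (fun x y _ _ => HF x y)
    (mkposreal 1 Rlt_0_1)) as [e He]. simpl in He.
  set (L := (b - a) + (d - c)).
  destruct (archimed_cor1 (e / (1 + L))) as [N [HN HN0]].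
  { apply Rdiv_lt_0_compat; [apply cond_pos | unfold L; lra]. }
  assert (N0 : 0 < INR N) by (apply lt_0_INR; lia).
  assert (step : L / INR N < e).
  { assert (L0 : 0 <= L) by (unfold L; lra). assert (e0 := cond_pos e).
    assert (X : L * / INR N <= L * (e / (1 + L))) by (apply Rmult_le_compat_l; lra).
    assert (Y : (1 + L) * (e / (1 + L)) = e) by (field; lra).
    assert (0 < e / (1 + L)) by (apply Rdiv_lt_0_compat; lra).
    unfold Rdiv at 1. lra. }
  exists (Rabs (F a c) + INR N). intros s t Hs Ht.
  (* follow the segment from [(a, c)] to [(s, t)] in [N] steps *)
  set (x := fun i => a + INR i / INR N * (s - a)).
  set (y := fun i => c + INR i / INR N * (t - c)).
  assert (chain : forall i, (i <= N)%nat -> Rabs (F (x i) (y i)) <= Rabs (F a c) + INR i).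
  { induction i as [|i IH]; intros Hi.
    - unfold x, y. simpl. replace (a + 0 / INR N * (s - a)) with a by (field; lra).
      replace (c + 0 / INR N * (t - c)) with c by (field; lra). lra.
    - specialize (IH ltac:(lia)).
      assert (B : forall j, (j <= N)%nat -> 0 <= INR j / INR N <= 1).
      { intros j Hj. split.
        - apply Rdiv_le_0_compat; [apply pos_INR | lra].
        - apply Rle_div_l; [lra|]. rewrite Rmult_1_l. now apply le_INR. }
      assert (B1 := B i ltac:(lia)). assert (B2 := B (S i) Hi).
      assert (D : INR (S i) / INR N = INR i / INR N + / INR N)
        by (rewrite S_INR; field; lra).
      assert (N1 : 0 < / INR N) by now apply Rinv_0_lt_compat.
      assert (Q : Rabs (F (x (S i)) (y (S i)) - F (x i) (y i)) < 1).
      { apply He; unfold x, y; try nra.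
        - replace (_ - _) with ((s - a) * / INR N) by (rewrite D; ring).
          rewrite Rabs_pos_eq by nra. unfold L, Rdiv in step. nra.
        - replace (_ - _) with ((t - c) * / INR N) by (rewrite D; ring).
          rewrite Rabs_pos_eq by nra. unfold L, Rdiv in step. nra. }
      assert (T := Rabs_triang (F (x (S i)) (y (S i)) - F (x i) (y i)) (F (x i) (y i))).
      replace (F (x (S i)) (y (S i)) - F (x i) (y i) + F (x i) (y i))
        with (F (x (S i)) (y (S i))) in T by ring.
      rewrite S_INR. lra. }
  specialize (chain N (le_n _)). unfold x, y in chain.
  replace (a + INR N / INR N * (s - a)) with s in chain by (field; lra).
  replace (c + INR N / INR N * (t - c)) with t in chain by (field; lra).
  exact chain.
Qed.

(** * Powers of the cosine and the cut-off test functions *)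

Definition cos_pow1 (n : nat) (t : R) := - INR n * cos t ^ (n - 1) * sin t.
(** The natural subtractions in the exponents truncate for [n <= 1], but exactly there the
    coefficient [INR n * INR (n - 1)] is 0; likewise [INR n] in [cos_pow1] for [n = 0]. *)
Definition cos_pow2 (n : nat) (t : R) :=
  INR n * INR (n - 1) * cos t ^ (n - 2) * sin t ^ 2 - INR n * cos t ^ n.

Lemma is_derive_cos_pow (n : nat) (t : R) :
  is_derive (fun t => cos t ^ n) t (cos_pow1 n t).
Proof.
  unfold cos_pow1. auto_derive; auto.
  replace (pred n) with (n - 1)%nat by lia. ring.
Qed.

Lemma is_derive_cos_pow1 (n : nat) (t : R) :
  is_derive (cos_pow1 n) t (cos_pow2 n t).
Proof.
  unfold cos_pow1, cos_pow2. auto_derive; auto.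
  replace (pred (n - 1)) with (n - 2)%nat by lia.
  destruct n as [|n]; [simpl; ring|].
  replace (S n - 1)%nat with n by lia. simpl (cos t ^ S n). ring.
Qed.

(* [cos ^ n] is, up to lower order terms, an eigenfunction of the angular part
   [sin^-3 d/dt (sin^3 d/dt)] of the operator. *)
Lemma cos_pow_angular (n : nat) (t : R) :
  sin t ^ 3 * cos_pow2 n t + 3 * sin t ^ 2 * cos t * cos_pow1 n t
  = sin t ^ 3 * (INR n * INR (n - 1) * cos t ^ (n - 2)
      - INR n * (INR n + 3) * cos t ^ n).
Proof.
  unfold cos_pow1, cos_pow2.
  assert (S2 : sin t ^ 2 = 1 - cos t ^ 2)
    by (assert (H := sin2_cos2 t); unfold Rsqr in H; simpl; lra).
  destruct n as [|[|n]].
  - simpl; ring.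
  - simpl. ring.
  - replace (S (S n) - 1)%nat with (S n) by lia.
    replace (S (S n) - 2)%nat with n by lia.
    replace (sin t ^ 3 * (INR (S (S n)) * INR (S n) * cos t ^ n * sin t ^ 2 -
      INR (S (S n)) * cos t ^ S (S n))) with
      (sin t ^ 3 * (INR (S (S n)) * INR (S n) * cos t ^ n * (1 - cos t ^ 2) -
      INR (S (S n)) * cos t ^ S (S n))) by (rewrite S2; ring).
    rewrite !S_INR. simpl (_ ^ S _). ring.
Qed.

(* The weight [cut eps t ^ 2] vanishes to second order where [sin t = eps], so
   that integrating by parts twice on [sin t >= eps] leaves no boundary terms. *)
Definition cut (eps t : R) := 1 - eps ^ 2 / sin t ^ 2.
Definition cut1 (eps t : R) := 2 * eps ^ 2 * cos t / sin t ^ 3.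
Definition cut2 (eps t : R) := - 2 * eps ^ 2 * (/ sin t ^ 2 + 3 * cos t ^ 2 / sin t ^ 4).

Definition test (eps : R) (n : nat) (t : R) := cos t ^ n * cut eps t ^ 2.
Definition test1 (eps : R) (n : nat) (t : R) :=
  cos_pow1 n t * cut eps t ^ 2 + 2 * cos t ^ n * cut eps t * cut1 eps t.
Definition test2 (eps : R) (n : nat) (t : R) :=
  cos_pow2 n t * cut eps t ^ 2 + 4 * cos_pow1 n t * cut eps t * cut1 eps t
  + 2 * cos t ^ n * (cut1 eps t ^ 2 + cut eps t * cut2 eps t).

Lemma is_derive_cut (eps t : R) : sin t <> 0 -> is_derive (cut eps) t (cut1 eps t).
Proof.
  intros Hs. unfold cut, cut1. auto_derive.
  - repeat split; auto. simpl; repeat apply Rmult_integral_contrapositive_currified; auto with real.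
  - simpl. field. auto.
Qed.

Lemma is_derive_cut1 (eps t : R) : sin t <> 0 -> is_derive (cut1 eps) t (cut2 eps t).
Proof.
  intros Hs. unfold cut1, cut2. auto_derive.
  - repeat split; auto. simpl; repeat apply Rmult_integral_contrapositive_currified; auto with real.
  - simpl. field. auto.
Qed.

Lemma is_derive_test (eps : R) (n : nat) (t : R) :
  sin t <> 0 -> is_derive (test eps n) t (test1 eps n t).
Proof.
  intros Hs. assert (E1 := is_derive_cos_pow n t). assert (E2 := is_derive_cut eps t Hs).
  unfold test, test1. auto_derive.
  - repeat split; auto; eexists; eassumption.
  - rewrite (is_derive_unique (fun x : R => cut eps x) _ _ E2).
    unfold cos_pow1. replace (pred n) with (n - 1)%nat by lia. ring.
Qed.

Lemma is_derive_test1 (eps : R) (n : nat) (t : R) :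
  sin t <> 0 -> is_derive (test1 eps n) t (test2 eps n t).
Proof.
  intros Hs. assert (E1 := is_derive_cos_pow1 n t). assert (E2 := is_derive_cut eps t Hs).
  assert (E3 := is_derive_cut1 eps t Hs).
  unfold test1, test2. auto_derive.
  - repeat split; auto; eexists; eassumption.
  - rewrite (is_derive_unique (fun x : R => cut eps x) _ _ E2).
    rewrite (is_derive_unique (fun x : R => cut1 eps x) _ _ E3).
    rewrite (is_derive_unique (fun x : R => cos_pow1 n x) _ _ E1).
    unfold cos_pow1. replace (pred n) with (n - 1)%nat by lia. ring.
Qed.

(** These are the terms in which a derivative falls on the cutoff. The contributions
    [cut * cos^2 / sin] of [cut2] and [cut1] have cancelled, because [sin^3 * cut1] is
    [2 eps^2 cos], with derivative [- 2 eps^2 sin]. *)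
Definition test_error (eps : R) (n : nat) (t : R) :=
  8 * eps ^ 2 * cos_pow1 n t * cut eps t * cos t
  + cos t ^ n * (4 * eps ^ 2 * (2 * eps ^ 2 * cos t ^ 2 / sin t ^ 3
      - sin t * cut eps t)).

Lemma test_angular (eps : R) (n : nat) (t : R) : sin t <> 0 ->
  sin t ^ 3 * test2 eps n t + 3 * sin t ^ 2 * cos t * test1 eps n t
  = INR n * INR (n - 1) * (sin t ^ 3 * test eps (n - 2) t)
    - INR n * (INR n + 3) * (sin t ^ 3 * test eps n t) + test_error eps n t.
Proof.
  intros Hs. assert (H := cos_pow_angular n t).
  transitivity ((sin t ^ 3 * cos_pow2 n t + 3 * sin t ^ 2 * cos t * cos_pow1 n t)
    * cut eps t ^ 2 + test_error eps n t).
  - clear H. unfold test1, test2, test_error.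
    generalize (cos_pow2 n t) (cos_pow1 n t) (cos t ^ n). intros c2 c1 c0.
    assert (C2 : cos t ^ 2 = 1 - sin t ^ 2)
      by (assert (H := sin2_cos2 t); unfold Rsqr in H; simpl; lra).
    assert (E2 : cut2 eps t = - 2 * eps ^ 2 * (/ sin t ^ 2 + 3 * (1 - sin t ^ 2) / sin t ^ 4))
      by (unfold cut2; now rewrite C2).
    assert (E1 : cut1 eps t ^ 2 = 4 * eps ^ 4 * (1 - sin t ^ 2) / sin t ^ 6)
      by (rewrite <- C2; unfold cut1; field; auto).
    assert (E1' : cos t * cut1 eps t = 2 * eps ^ 2 * (1 - sin t ^ 2) / sin t ^ 3)
      by (rewrite <- C2; unfold cut1; field; auto).
    rewrite C2.
    transitivity (sin t ^ 3 * (c2 * cut eps t ^ 2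
       + 4 * c1 * cut eps t * cut1 eps t + 2 * c0 * (cut1 eps t ^ 2 + cut eps t * cut2 eps t))
       + 3 * sin t ^ 2 * cos t * c1 * cut eps t ^ 2
       + 6 * sin t ^ 2 * c0 * cut eps t * (cos t * cut1 eps t)); [ring|].
    rewrite E1', E1, E2. unfold cut1, cut. field. auto.
  - rewrite H. unfold test. ring.
Qed.
Lemma Rabs_cos_pow_le1 (n : nat) (t : R) : Rabs (cos t ^ n) <= 1.
Proof.
  rewrite <- RPow_abs, <- (pow1 n). apply pow_incr. split; [apply Rabs_pos|].
  apply Rabs_le. assert (H := COS_bound t). lra.
Qed.

Lemma Rabs_mult_le (x y a b : R) : Rabs x <= a -> Rabs y <= b -> Rabs (x * y) <= a * b.
Proof.
  intros Hx Hy. rewrite Rabs_mult.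
  apply Rmult_le_compat; auto using Rabs_pos.
Qed.

Lemma cut_bound (eps t : R) : 0 < eps -> eps <= sin t -> 0 <= cut eps t <= 1.
Proof.
  intros He Hs. unfold cut.
  assert (P : 0 < sin t ^ 2) by (apply pow_lt; lra).
  assert (0 <= eps ^ 2 / sin t ^ 2) by (apply Rdiv_le_0_compat; [apply pow2_ge_0 | lra]).
  assert (eps ^ 2 / sin t ^ 2 <= 1).
  { apply Rle_div_l; [lra|]. rewrite Rmult_1_l. apply pow_incr. lra. }
  lra.
Qed.

Lemma Rabs_cos_pow1_le (n : nat) (t : R) : Rabs (cos_pow1 n t) <= INR n.
Proof.
  unfold cos_pow1. rewrite <- (Rmult_1_r (INR n)) at 2.
  apply Rabs_mult_le; [|apply Rabs_le; assert (H := SIN_bound t); lra].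
  rewrite <- (Rmult_1_r (INR n)) at 2. apply Rabs_mult_le; [|apply Rabs_cos_pow_le1].
  rewrite Rabs_Ropp, Rabs_pos_eq by apply pos_INR. lra.
Qed.

(** The only negative power of [sin t] left outside [cut] is in [eps^4 / sin^3], which is at most
    [eps] where [sin t >= eps]. The constant is 8 from this term, 4 from the [sin * cut] term and
    [8 * INR n] from the cross term. *)
Lemma test_error_le (eps : R) (n : nat) (t : R) :
  0 < eps <= 1 -> eps <= sin t -> Rabs (test_error eps n t) <= (12 + 8 * INR n) * eps.
Proof.
  intros He Hs. unfold test_error.
  assert (Hc := cut_bound eps t ltac:(lra) Hs).
  assert (Hc' : Rabs (cut eps t) <= 1) by (rewrite Rabs_pos_eq; lra).
  assert (Hcos : Rabs (cos t) <= 1)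
    by (apply Rabs_le; assert (H := COS_bound t); lra).
  assert (E2 : eps ^ 2 <= eps) by (simpl; nra).
  assert (E0 : 0 <= eps ^ 2) by apply pow2_ge_0.
  assert (n0 := pos_INR n).
  assert (S1 : sin t <= 1) by apply SIN_bound.
  eapply Rle_trans; [apply Rabs_triang|].
  replace ((12 + 8 * INR n) * eps) with ((8 * eps) * INR n * 1 * 1 + 1 * (12 * eps)) by ring.
  apply Rplus_le_compat.
  - apply Rabs_mult_le; [apply Rabs_mult_le; [apply Rabs_mult_le|]|];
      auto using Rabs_cos_pow1_le.
    rewrite Rabs_pos_eq; lra.
  - apply Rabs_mult_le; [apply Rabs_cos_pow_le1|].
    assert (P3 : 0 < sin t ^ 3) by (apply pow_lt; lra).
    assert (Q : 0 <= eps ^ 3 * cos t ^ 2 / sin t ^ 3 <= 1).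
    { split.
      - apply Rdiv_le_0_compat; auto. apply Rmult_le_pos; [apply pow_le; lra | apply pow2_ge_0].
      - apply Rle_div_l; [lra|].
        assert (eps ^ 3 <= sin t ^ 3) by (apply pow_incr; lra).
        assert (0 <= cos t ^ 2 <= 1).
        { split; [apply pow2_ge_0|]. assert (H' := COS_bound t). simpl. nra. }
        assert (0 <= eps ^ 3) by (apply pow_le; lra). nra. }
    replace (4 * eps ^ 2 * (2 * eps ^ 2 * cos t ^ 2 / sin t ^ 3 - sin t * cut eps t))
      with (8 * eps * (eps ^ 3 * cos t ^ 2 / sin t ^ 3) - 4 * eps ^ 2 * (sin t * cut eps t))
      by (field; lra).
    assert (0 <= sin t * cut eps t <= 1) by nra.
    set (q := eps ^ 3 * cos t ^ 2 / sin t ^ 3) in *. set (w := sin t * cut eps t) in *.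
    apply Rabs_le. nra.
Qed.

Lemma test_approx (eps : R) (n : nat) (t : R) :
  0 < eps <= 1 -> eps <= sin t ->
  Rabs (sin t ^ 3 * test eps n t - sin t ^ 3 * cos t ^ n) <= 2 * eps.
Proof.
  intros He Hs. assert (Hc := cut_bound eps t ltac:(lra) Hs).
  assert (S1 : sin t <= 1) by apply SIN_bound.
  unfold test.
  (* From [cut^2 - 1 = (cut - 1) (cut + 1)] and [cut - 1 = - eps^2 / sin^2], whose denominator the
     weight [sin^3] absorbs. *)
  replace (_ - _) with (cos t ^ n * (- (eps ^ 2 * sin t * (1 + cut eps t))))
    by (unfold cut; field; lra).
  rewrite <- (Rmult_1_l (2 * eps)).
  apply Rabs_mult_le; [apply Rabs_cos_pow_le1|].
  rewrite Rabs_Ropp, Rabs_pos_eq.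
  - assert (0 <= eps ^ 2 <= eps) by (simpl; nra).
    replace (2 * eps) with (eps * 1 * 2) by ring.
    apply Rmult_le_compat; try lra; nra.
  - apply Rmult_le_pos; [|lra]. apply Rmult_le_pos; [apply pow2_ge_0 | lra].
Qed.

(** * Moments, cut moments and their approximate differential equation *)

Lemma asin_pos (x : R) : 0 < x < 1 -> 0 < asin x.
Proof.
  intros Hx. assert (B := asin_bound x). assert (P := PI_RGT_0).
  destruct (Rle_or_lt (asin x) 0) as [H|H]; [exfalso|exact H].
  assert (S : sin (asin x) <= sin 0) by (apply sin_incr_1; lra).
  rewrite sin_0, sin_asin in S; lra.
Qed.

Lemma sin_ge_asin (eps t : R) : 0 < eps < 1 -> asin eps <= t <= PI - asin eps -> eps <= sin t.
Proof.
  intros He Ht. assert (B := asin_bound_lt eps ltac:(lra)). assert (P := PI_RGT_0).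
  assert (A0 := asin_pos eps He).
  assert (S : sin (asin eps) = eps) by (apply sin_asin; lra).
  rewrite <- S. destruct (Rle_or_lt t (PI / 2)).
  - apply sin_incr_1; lra.
  - rewrite <- (sin_PI_x t). apply sin_incr_1; lra.
Qed.

Lemma sin_le_asin (eps t : R) : 0 < eps < 1 ->
  0 <= t <= asin eps \/ PI - asin eps <= t <= PI -> 0 <= sin t <= eps.
Proof.
  intros He Ht. assert (B := asin_bound_lt eps ltac:(lra)). assert (P := PI_RGT_0).
  assert (S : sin (asin eps) = eps) by (apply sin_asin; lra).
  split; [apply sin_ge_0; lra|]. rewrite <- S. destruct Ht as [Ht|Ht].
  - apply sin_incr_1; lra.
  - rewrite <- (sin_PI_x t). apply sin_incr_1; lra.
Qed.

Definition moment (F : R -> R -> R) (n : nat) (s : R) : R :=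
  RInt (fun t => F s t * (sin t ^ 3 * cos t ^ n)) 0 PI.

(** The limits are the two angles where [sin t = eps], that is, the zeros of the cutoff. *)
Definition cut_moment (F : R -> R -> R) (eps : R) (n : nat) (s : R) : R :=
  RInt (fun t => F s t * (sin t ^ 3 * test eps n t)) (asin eps) (PI - asin eps).

Lemma continuity_pt_sin_pow (n : nat) (t : R) : continuity_pt (fun t => sin t ^ n) t.
Proof.
  apply (continuity_pt_comp sin (fun x => x ^ n)); [apply continuity_sin|].
  apply derivable_continuous_pt, derivable_pt_pow.
Qed.

Lemma continuity_pt_cos_pow (n : nat) (t : R) : continuity_pt (fun t => cos t ^ n) t.
Proof.
  apply (continuity_pt_comp cos (fun x => x ^ n)); [apply continuity_cos|].
  apply derivable_continuous_pt, derivable_pt_pow.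
Qed.

Lemma ex_RInt_moment (F : R -> R -> R) (n : nat) (s a b : R) :
  a <= b -> (forall s t, continuity_2d_pt F s t) ->
  ex_RInt (fun t => F s t * (sin t ^ 3 * cos t ^ n)) a b.
Proof.
  intros Hab HF. apply ex_RInt_continuity_pt; auto. intros t _.
  apply continuity_pt_mult; [now apply continuity_2d_pt_slice|].
  apply continuity_pt_mult; [apply continuity_pt_sin_pow | apply continuity_pt_cos_pow].
Qed.

Lemma continuity_pt_test_weight (eps : R) (n : nat) (t : R) :
  sin t <> 0 -> continuity_pt (fun t => sin t ^ 3 * test eps n t) t.
Proof.
  intros Hs. apply continuity_pt_mult; [apply continuity_pt_sin_pow|].
  eapply continuity_pt_of_is_derive. now apply is_derive_test.
Qed.

Lemma ex_RInt_cut_moment (F : R -> R -> R) (eps : R) (n : nat) (s : R) :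
  0 < eps < 1 -> (forall s t, continuity_2d_pt F s t) ->
  ex_RInt (fun t => F s t * (sin t ^ 3 * test eps n t)) (asin eps) (PI - asin eps).
Proof.
  intros He HF. assert (B := asin_bound_lt eps ltac:(lra)).
  apply ex_RInt_continuity_pt; [lra|]. intros t Ht.
  apply continuity_pt_mult; [now apply continuity_2d_pt_slice|].
  apply continuity_pt_test_weight. assert (H := sin_ge_asin eps t He Ht). lra.
Qed.

(** On the two discarded caps the weight [sin^3] is at most [eps], and between them [test_approx]
    applies. The estimate needs only a bound on [F], no derivative. *)
Lemma cut_moment_approx (F : R -> R -> R) (eps : R) (n : nat) (s K : R) :
  0 < eps < 1 -> (forall s t, continuity_2d_pt F s t) ->
  (forall t, 0 <= t <= PI -> Rabs (F s t) <= K) ->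
  Rabs (cut_moment F eps n s - moment F n s) <= 4 * PI * K * eps.
Proof.
  intros He HF HK. assert (B := asin_bound_lt eps ltac:(lra)).
  assert (A0 := asin_pos eps He).
  assert (P := PI_RGT_0).
  set (a := asin eps) in *. set (G := fun t => F s t * (sin t ^ 3 * cos t ^ n)).
  assert (I : forall x y, x <= y -> ex_RInt G x y) by (intros; now apply ex_RInt_moment).
  assert (Ch : moment F n s = RInt G 0 a + RInt G a (PI - a) + RInt G (PI - a) PI).
  { unfold moment. fold G.
    rewrite <- (RInt_Chasles G 0 (PI - a) PI) by (apply I; lra).
    rewrite <- (RInt_Chasles G 0 a (PI - a)) by (apply I; lra). reflexivity. }
  assert (K0 : 0 <= K) by (assert (H := HK 0 ltac:(lra)); assert (H1 := Rabs_pos (F s 0)); lra).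
  assert (small : forall t, 0 <= t <= a \/ PI - a <= t <= PI -> Rabs (G t) <= K * eps).
  { intros t Ht. assert (S := sin_le_asin eps t He Ht).
    unfold G. apply Rabs_mult_le; [apply HK; lra|]. rewrite <- (Rmult_1_r eps).
    apply Rabs_mult_le; [|apply Rabs_cos_pow_le1].
    rewrite Rabs_pos_eq by (apply pow_le; lra). simpl.
    assert (sin t * sin t <= 1) by nra. nra. }
  assert (E1 : Rabs (RInt G 0 a) <= (a - 0) * (K * eps))
    by (apply abs_RInt_le_const; [lra | apply I; lra | intros; apply small; lra]).
  assert (E3 : Rabs (RInt G (PI - a) PI) <= (PI - (PI - a)) * (K * eps))
    by (apply abs_RInt_le_const; [lra | apply I; lra | intros; apply small; lra]).
  assert (J := ex_RInt_cut_moment F eps n s He HF). fold a in J.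
  assert (E2 : Rabs (cut_moment F eps n s - RInt G a (PI - a))
    <= ((PI - a) - a) * (K * (2 * eps))).
  { unfold cut_moment. fold a.
    rewrite <- (RInt_minus (V := R_CompleteNormedModule) _ _ _ _ J
      (I a (PI - a) ltac:(lra)) : RInt (fun t => _ - _) _ _ = _ - _).
    apply abs_RInt_le_const; [lra| |].
    - apply (ex_RInt_minus (V := R_NormedModule)); [exact J | apply I; lra].
    - intros t Ht. assert (S := sin_ge_asin eps t He Ht). unfold G.
      rewrite <- Rmult_minus_distr_l.
      apply Rabs_mult_le; [apply HK; lra | apply test_approx; lra]. }
  rewrite Ch.
  apply Rabs_le_between in E1. apply Rabs_le_between in E2. apply Rabs_le_between in E3.
  assert (Ke : 0 <= K * eps) by (apply Rmult_le_pos; lra).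
  apply Rabs_le. nra.
Qed.

Lemma moment_approx_solution (F Fs Ft Fss Ftt : R -> R -> R) (n : nat) (h : R) :
  polar_solution F Fs Ft Fss Ftt -> (forall s t, continuity_2d_pt F s t) ->
  (forall s, INR n * INR (n - 1) * moment F (n - 2) s = - h) ->
  approx_solution (INR n * (INR n + 3)) h (moment F n).
Proof.
  intros HF HC Hh A B delta HAB Hd. assert (P := PI_RGT_0).
  destruct (continuity_2d_bounded F A B 0 PI ltac:(lra) ltac:(lra) HC) as [K HK].
  assert (K0 : 0 <= K)
    by (assert (H := HK A 0 ltac:(lra) ltac:(lra)); assert (H1 := Rabs_pos (F A 0)); lra).
  assert (n0 := pos_INR n). assert (n1 := pos_INR (n - 1)).
  set (c := INR n * INR (n - 1)).
  assert (c0 : 0 <= c) by now apply Rmult_le_pos.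
  (* Error budget per unit of [eps]: [4 * PI * K * c] for replacing the cut moment of order [n - 2]
     by the true one, [PI * K * (12 + 8 * INR n)] for [test_error], and 1 to keep [D] positive. It
     also covers the distance [4 * PI * K] between [u] and the moment. *)
  set (D := PI * K * (4 * c + 12 + 8 * INR n) + 1).
  assert (PK : 0 <= PI * K) by (apply Rmult_le_pos; lra).
  assert (D1 : 1 <= D).
  { assert (0 <= PI * K * (4 * c + 12 + 8 * INR n)) by (apply Rmult_le_pos; lra).
    unfold D; lra. }
  set (eps := Rmin (/ 2) (delta / D)).
  assert (He : 0 < eps < 1).
  { assert (eps <= / 2) by apply Rmin_l. split; [|lra].
    apply Rmin_pos; [lra|]. apply Rdiv_lt_0_compat; lra. }
  assert (HeD : D * eps <= delta).
  { assert (X : eps <= delta / D) by apply Rmin_r.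
    apply (Rmult_le_compat_l D) in X; [|lra].
    replace (D * (delta / D)) with delta in X by (field; lra). exact X. }
  assert (Ba := asin_bound_lt eps ltac:(lra)).
  assert (A0 := asin_pos eps He).
  assert (sin0 : forall t, asin eps <= t <= PI - asin eps -> sin t <> 0).
  { intros t Ht. assert (H := sin_ge_asin eps t He Ht). lra. }
  exists (cut_moment F eps n), (cut_moment Fs eps n), (cut_moment Fss eps n).
  split; [|split].
  - intros s. apply (is_derive_RInt_weighted F Fs _ 0 PI); try lra.
    + intros z t Ht. now apply HF.
    + intros z t Ht. apply HC.
    + intros z t Ht. now apply HF.
    + intros t Ht. apply continuity_pt_test_weight; auto.
  - intros s. apply (is_derive_RInt_weighted Fs Fss _ 0 PI); try lra.
    + intros z t Ht. now apply HF.
    + intros z t Ht. now apply HF.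
    + intros z t Ht. now apply HF.
    + intros t Ht. apply continuity_pt_test_weight; auto.
  - intros s Hs.
    assert (M : forall j, Rabs (cut_moment F eps j s - moment F j s) <= 4 * PI * K * eps).
    { intros j. apply cut_moment_approx; auto. }
    split.
    { eapply Rle_trans; [apply M|]. apply Rle_trans with (D * eps); [|exact HeD].
      apply Rmult_le_compat_r; [lra|]. unfold D. nra. }
    assert (cutz : forall t, sin t = eps -> cut eps t = 0)
      by (intros t E; unfold cut; rewrite E; field; lra).
    assert (cut_a : cut eps (asin eps) = 0) by (apply cutz, sin_asin; lra).
    assert (cut_b : cut eps (PI - asin eps) = 0)
      by (apply cutz; rewrite sin_PI_x; apply sin_asin; lra).
    assert (C2 : forall t, sin t <> 0 -> continuity_pt (test2 eps n) t).
    { intros t Ht. apply continuity_pt_filterlim.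
      apply (ex_derive_continuous (test2 eps n) t).
      assert (E1 := is_derive_cut eps t Ht). assert (E2 := is_derive_cut1 eps t Ht).
      assert (E3 := is_derive_cos_pow1 n t).
      unfold test2, cos_pow2, cut2. auto_derive.
      repeat split; auto; try (eexists; eassumption);
        simpl; repeat apply Rmult_integral_contrapositive_currified; auto with real. }
    assert (W := polar_solution_weak F Fs Ft Fss Ftt (test eps n) (test1 eps n)
      (test2 eps n) (asin eps) (PI - asin eps) s HF A0 ltac:(lra) ltac:(lra)
      (fun t Ht => is_derive_test eps n t (sin0 t Ht))
      (fun t Ht => is_derive_test1 eps n t (sin0 t Ht))
      (fun t Ht => C2 t (sin0 t Ht))
      ltac:(unfold test; rewrite cut_a; ring) ltac:(unfold test1; rewrite cut_a; ring)
      ltac:(unfold test; rewrite cut_b; ring) ltac:(unfold test1; rewrite cut_b; ring)).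
    fold (cut_moment Fss eps n s) (cut_moment Fs eps n s) in W.
    set (a := asin eps) in *.
    assert (I : forall j, is_RInt (fun t => F s t * (sin t ^ 3 * test eps j t)) a (PI - a)
      (cut_moment F eps j s)).
    { intros j. apply (RInt_correct (V := R_CompleteNormedModule)).
      now apply ex_RInt_cut_moment. }
    assert (IE : ex_RInt (fun t => F s t * test_error eps n t) a (PI - a)).
    { apply ex_RInt_continuity_pt; [lra|]. intros t Ht.
      apply continuity_pt_mult; [now apply continuity_2d_pt_slice|].
      apply continuity_pt_filterlim, (ex_derive_continuous (test_error eps n) t).
      assert (E1 := is_derive_cut eps t (sin0 t Ht)).
      assert (E3 := is_derive_cos_pow1 n t).
      unfold test_error. auto_derive.
      assert (S0 := sin0 t Ht).
      repeat split; auto; try (eexists; eassumption);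
        simpl; repeat apply Rmult_integral_contrapositive_currified; auto with real. }
    assert (EB : Rabs (RInt (fun t => F s t * test_error eps n t) a (PI - a))
      <= (PI - a - a) * (K * ((12 + 8 * INR n) * eps))).
    { apply abs_RInt_le_const; [lra | exact IE |]. intros t Ht.
      apply Rabs_mult_le; [apply HK; lra|]. apply test_error_le; [lra|].
      now apply sin_ge_asin. }
    assert (V : RInt (fun t => F s t * (sin t ^ 3 * test2 eps n t
        + 3 * sin t ^ 2 * cos t * test1 eps n t)) a (PI - a)
      = c * cut_moment F eps (n - 2) s - INR n * (INR n + 3) * cut_moment F eps n s
        + RInt (fun t => F s t * test_error eps n t) a (PI - a)).
    { apply (is_RInt_unique (V := R_CompleteNormedModule)).
      apply (RInt_correct (V := R_CompleteNormedModule)) in IE.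
      assert (L := is_RInt_plus _ _ _ _ _ _ (is_RInt_minus _ _ _ _ _ _
        (is_RInt_scal _ _ _ c _ (I (n - 2)%nat))
        (is_RInt_scal _ _ _ (INR n * (INR n + 3)) _ (I n))) IE).
      revert L. apply is_RInt_ext. rewrite Rmin_left, Rmax_right by lra.
      intros t Ht. rewrite test_angular by (apply sin0; lra).
      unfold minus, opp, plus, scal. simpl. unfold mult. simpl. unfold c. ring. }
    rewrite V in W.
    assert (M2 := M (n - 2)%nat). specialize (Hh s). fold c in Hh.
    (* By the weak form the terms in the moment of order [n] cancel, and [h] is [- c] times the true
       moment of order [n - 2]; only the two errors remain. *)
    replace (_ - _ - h) with (- (c * (cut_moment F eps (n - 2) s - moment F (n - 2) s))
      - RInt (fun t => F s t * test_error eps n t) a (PI - a)) by lra.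
    apply Rle_trans with (D * eps); [|exact HeD].
    apply Rabs_le_between in EB. apply Rabs_le_between in M2.
    set (x := cut_moment F eps (n - 2) s - moment F (n - 2) s) in *.
    assert (Y : - (c * (4 * PI * K * eps)) <= c * x <= c * (4 * PI * K * eps)) by nra.
    assert (Z : (PI - a - a) * (K * ((12 + 8 * INR n) * eps))
      <= PI * (K * ((12 + 8 * INR n) * eps))).
    { apply Rmult_le_compat_r; [|lra]. apply Rmult_le_pos; [lra|]. nra. }
    unfold D. apply Rabs_le. nra.
Qed.

(** * Determinacy: a continuous function with vanishing cosine moments is zero *)

(** Each factor of the quadratic shifts the exponent of [cos t] by 0, 1 or 2; the free [n] keeps the
    induction on [N] going. *)
Lemma cos_moments_quadratic (w : R -> R) (a b c : R) (N n : nat) :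
  (forall t, continuity_pt w t) ->
  (forall n, RInt (fun t => w t * cos t ^ n) 0 PI = 0) ->
  is_RInt (fun t => w t * cos t ^ n * (a + b * cos t + c * cos t ^ 2) ^ N) 0 PI 0.
Proof.
  intros Hw Hm. revert n. assert (P := PI_RGT_0). induction N as [|N IH]; intros n.
  - apply (is_RInt_ext (fun t => w t * cos t ^ n)); [intros; simpl; ring|].
    evar_last; [|exact (Hm n)]. apply (RInt_correct (V := R_CompleteNormedModule)), ex_RInt_continuity_pt; [lra|].
    intros t _. apply continuity_pt_mult; auto using continuity_pt_cos_pow.
  - assert (L := is_RInt_plus _ _ _ _ _ _ (is_RInt_plus _ _ _ _ _ _
      (is_RInt_scal _ _ _ a _ (IH n)) (is_RInt_scal _ _ _ b _ (IH (S n))))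
      (is_RInt_scal _ _ _ c _ (IH (S (S n))))).
    evar_last.
    + eapply is_RInt_ext; [|exact L]. intros t _.
      unfold plus, scal. simpl. unfold mult. simpl. ring.
    + unfold plus, scal. simpl. unfold mult. simpl. ring.
Qed.

(** Bernoulli's inequality: linear growth in the exponent is enough for the concentration argument
    that follows. *)
Lemma Rle_pow_ge1 (x : R) (n : nat) : 0 <= x -> 1 + INR n * x <= (1 + x) ^ n.
Proof.
  intros Hx. induction n as [|n IH]; [simpl; lra|].
  rewrite S_INR. simpl ((1 + x) ^ S n).
  assert (n0 := pos_INR n). assert (0 <= INR n * x * x) by (apply Rmult_le_pos; [apply Rmult_le_pos|]; lra).
  nra.
Qed.

Lemma RInt_ge_const (f : R -> R) (a b m : R) :
  a <= b -> ex_RInt f a b -> (forall t, a < t < b -> m <= f t) ->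
  m * (b - a) <= RInt f a b.
Proof.
  intros Hab Hf Hm.
  assert (H := RInt_le (fun _ => m) f a b Hab (ex_RInt_const a b m) Hf Hm).
  rewrite (RInt_const (V := R_CompleteNormedModule)) in H.
  unfold scal in H. simpl in H. unfold mult in H. simpl in H. lra.
Qed.

(* The powers of [1 + (k^2 - (cos t - cos t0)^2) / 4] concentrate at [t0]:
   away from [t0] the base lies in [[0, 1]], near [t0] it is above [1]. *)
Lemma cos_moments_vanish_le (w : R -> R) (t0 : R) :
  (forall t, continuity_pt w t) ->
  (forall n, RInt (fun t => w t * cos t ^ n) 0 PI = 0) ->
  0 < t0 < PI -> w t0 <= 0.
Proof.
  intros Hw Hm Ht0. destruct (Rle_or_lt (w t0) 0) as [|W]; [assumption|exfalso].
  assert (P := PI_RGT_0).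
  assert (near : forall g : R -> R, continuity_pt g t0 -> forall e, 0 < e ->
    exists d, 0 < d /\ forall t, Rabs (t - t0) <= d -> Rabs (g t - g t0) < e).
  { intros g Hg e He. destruct (Hg e He) as [d [Hd Hd']].
    exists (d / 2). split; [lra|]. intros t Ht.
    destruct (Req_dec t0 t) as [->|Hne].
    - rewrite Rminus_diag, Rabs_R0. exact He.
    - apply Hd'. split; [split; [exact I | exact Hne]|].
      simpl. unfold Rdist. lra. }
  destruct (near w (Hw t0) (w t0 / 2) ltac:(lra)) as [d [Hd Hdw]].
  set (r := Rmin d (Rmin (t0 / 2) ((PI - t0) / 2))).
  assert (r1 : r <= d) by apply Rmin_l.
  assert (r2 : r <= t0 / 2) by (eapply Rle_trans; [apply Rmin_r | apply Rmin_l]).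
  assert (r3 : r <= (PI - t0) / 2) by (eapply Rle_trans; [apply Rmin_r | apply Rmin_r]).
  assert (r0 : 0 < r) by (unfold r; repeat apply Rmin_pos; lra).
  set (c0 := cos t0).
  (* Since [cos] decreases on [[0, PI]], [|cos t - c0| >= k] holds outside the [r]-neighbourhood of
     [t0]. *)
  set (k := Rmin (cos (t0 - r) - c0) (c0 - cos (t0 + r))).
  assert (k1 : k <= cos (t0 - r) - c0) by apply Rmin_l.
  assert (k2 : k <= c0 - cos (t0 + r)) by apply Rmin_r.
  assert (k0 : 0 < k).
  { unfold k, c0. apply Rmin_pos.
    - assert (H := cos_decreasing_1 (t0 - r) t0 ltac:(lra) ltac:(lra) ltac:(lra) ltac:(lra) ltac:(lra)). lra.
    - assert (H := cos_decreasing_1 t0 (t0 + r) ltac:(lra) ltac:(lra) ltac:(lra) ltac:(lra) ltac:(lra)). lra. }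
  (* The divisor 4 keeps [q >= 0], because [|cos t - c0| <= 2]. *)
  set (q := fun t => 1 + (k ^ 2 - (cos t - c0) ^ 2) / 4).
  assert (q0 : forall t, 0 <= q t).
  { intros t. unfold q. assert (H := COS_bound t). assert (H0 := COS_bound t0).
    fold c0 in H0. nra. }
  assert (qout : forall t, 0 <= t <= t0 - r \/ t0 + r <= t <= PI -> q t <= 1).
  { intros t Ht. assert (X : k ^ 2 <= (cos t - c0) ^ 2); [|unfold q; lra].
    destruct Ht as [Ht|Ht].
    - assert (H := cos_decr_1 t (t0 - r) ltac:(lra) ltac:(lra) ltac:(lra) ltac:(lra) ltac:(lra)).
      apply pow_incr. lra.
    - assert (H := cos_decr_1 (t0 + r) t ltac:(lra) ltac:(lra) ltac:(lra) ltac:(lra) ltac:(lra)).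
      replace ((cos t - c0) ^ 2) with ((c0 - cos t) ^ 2) by ring.
      apply pow_incr. lra. }
  destruct (near cos (continuity_cos t0) (k / 2) ltac:(lra)) as [d' [Hd' Hdc]].
  set (r' := Rmin d' r).
  assert (r'1 : r' <= d') by apply Rmin_l. assert (r'2 : r' <= r) by apply Rmin_r.
  assert (r'0 : 0 < r') by (apply Rmin_pos; lra).
  (* Within [r'] of [t0] one has [|cos t - c0| < k / 2], so [q] exceeds 1 by at least [3 k^2 / 16],
     hence by [x]. *)
  set (x := k ^ 2 / 8). assert (x0 : 0 < x) by (unfold x; assert (0 < k ^ 2) by (apply pow_lt; lra); lra).
  assert (qin : forall t, Rabs (t - t0) <= r' -> 1 + x <= q t).
  { intros t Ht. specialize (Hdc t ltac:(lra)). fold c0 in Hdc.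
    apply Rabs_def2 in Hdc. unfold q, x. nra. }
  destruct (continuity_ab_maj (fun t => - w t) 0 PI) as [tm [HK _]]; [lra| |].
  { intros t _. now apply continuity_pt_opp. }
  set (K := Rmax 0 (- w tm)).
  assert (HK' : forall t, 0 <= t <= PI -> - K <= w t).
  { intros t Ht. specialize (HK t Ht). assert (H := Rmax_r 0 (- w tm)).
    fold K in H. lra. }
  assert (K0 : 0 <= K) by apply Rmax_l.
  assert (wpos : forall t, Rabs (t - t0) <= r -> w t0 / 2 <= w t).
  { intros t Ht. specialize (Hdw t ltac:(lra)). apply Rabs_def2 in Hdw. lra. }
  assert (Hq : forall N, is_RInt (fun t => w t * q t ^ N) 0 PI 0).
  { intros N. assert (H := cos_moments_quadratic w (1 + (k ^ 2 - c0 ^ 2) / 4)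
      (c0 / 2) (- / 4) N 0 Hw Hm).
    revert H. apply is_RInt_ext. intros t _. simpl (cos t ^ 0). rewrite Rmult_1_r.
    f_equal. f_equal. unfold q. field. }
  (* This covers the intermediate zone too, where [q] may exceed 1: [w] is positive there, so the
     product is nonnegative. Where [w <= 0], the point lies outside the [r]-neighbourhood and
     [q <= 1]. *)
  assert (low : forall t N, 0 <= t <= PI -> - K <= w t * q t ^ N).
  { intros t N Ht. assert (Q := pow_le _ N (q0 t)).
    destruct (Rle_or_lt (w t) 0) as [Hwt|Hwt].
    - assert (Q1 : q t ^ N <= 1).
      { rewrite <- (pow1 N). apply pow_incr. split; [apply q0|]. apply qout.
        destruct (Rle_or_lt t (t0 - r)) as [|L1]; [lra|].
        destruct (Rle_or_lt (t0 + r) t) as [|L2]; [lra|exfalso].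
        assert (H := wpos t ltac:(apply Rabs_le; lra)). lra. }
      specialize (HK' t Ht). nra.
    - assert (0 <= w t * q t ^ N) by (apply Rmult_le_pos; lra). lra. }
  (* [N] makes the integral over the [r']-neighbourhood, at least [2 r' (w t0 / 2) (1 + N x)],
     outweigh the worst loss [K * PI] elsewhere, so the total cannot be 0. *)
  destruct (INR_unbounded (K * PI / (2 * r' * (w t0 / 2) * x))) as [N HN].
  assert (pp : 0 < 2 * r' * (w t0 / 2) * x).
  { repeat apply Rmult_lt_0_compat; lra. }
  apply (Rmult_gt_compat_r (2 * r' * (w t0 / 2) * x)) in HN; [|lra].
  replace (K * PI / (2 * r' * (w t0 / 2) * x) * (2 * r' * (w t0 / 2) * x)) with (K * PI)
    in HN by (field; lra).
  set (G := fun t => w t * q t ^ N).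
  assert (I : forall u v, u <= v -> ex_RInt G u v).
  { intros u v Huv. apply ex_RInt_continuity_pt; auto. intros t _.
    apply continuity_pt_mult; auto.
    apply (continuity_pt_comp q (fun y => y ^ N)).
    - apply continuity_pt_filterlim, (ex_derive_continuous q t).
      unfold q. auto_derive. auto.
    - apply derivable_continuous_pt, derivable_pt_pow. }
  assert (Z : RInt G 0 PI = 0) by (apply (is_RInt_unique (V := R_CompleteNormedModule)), Hq).
  rewrite <- (RInt_Chasles G 0 (t0 + r') PI) in Z by (apply I; lra).
  rewrite <- (RInt_Chasles G 0 (t0 - r') (t0 + r')) in Z by (apply I; lra).
  unfold plus in Z. simpl in Z.
  assert (Z1 := RInt_ge_const G 0 (t0 - r') (- K) ltac:(lra) ltac:(apply I; lra)
    ltac:(intros; apply low; lra)).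
  assert (Z3 := RInt_ge_const G (t0 + r') PI (- K) ltac:(lra) ltac:(apply I; lra)
    ltac:(intros; apply low; lra)).
  assert (Z2 := RInt_ge_const G (t0 - r') (t0 + r') (w t0 / 2 * (1 + INR N * x))
    ltac:(lra) ltac:(apply I; lra)).
  assert (Z2' : forall t, t0 - r' < t < t0 + r' -> w t0 / 2 * (1 + INR N * x) <= G t).
  { intros t Ht. unfold G.
    assert (n0 : 0 <= INR N * x) by (apply Rmult_le_pos; [apply pos_INR | lra]).
    apply Rmult_le_compat; try lra.
    - apply wpos, Rabs_le. lra.
    - eapply Rle_trans; [apply Rle_pow_ge1; lra|]. apply pow_incr.
      split; [lra|]. apply qin, Rabs_le. lra. }
  specialize (Z2 Z2').
  assert (0 < K * r' + w t0 * r' ) by nra.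
  nra.
Qed.

Lemma cos_moments_vanish (w : R -> R) (t : R) :
  (forall t, continuity_pt w t) ->
  (forall n, RInt (fun t => w t * cos t ^ n) 0 PI = 0) ->
  0 < t < PI -> w t = 0.
Proof.
  intros Hw Hm Ht. apply Rle_antisym; [now apply cos_moments_vanish_le|].
  cut (- w t <= 0); [lra|].
  apply (cos_moments_vanish_le (fun t => - w t)); auto.
  - intros. now apply continuity_pt_opp.
  - intros n. apply (is_RInt_unique (V := R_CompleteNormedModule)).
    assert (E : is_RInt (fun t => w t * cos t ^ n) 0 PI 0).
    { evar_last; [|exact (Hm n)]. apply (RInt_correct (V := R_CompleteNormedModule)).
      apply ex_RInt_continuity_pt; [assert (P := PI_RGT_0); lra|]. intros.
      apply continuity_pt_mult; auto using continuity_pt_cos_pow. }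
    apply is_RInt_opp in E. unfold opp in E. simpl in E. rewrite Ropp_0 in E.
    revert E. apply is_RInt_ext. intros. simpl. ring.
Qed.

(** * Independence of the radial variable *)

Lemma moment_const (F Fs Ft Fss Ftt : R -> R -> R) :
  polar_solution F Fs Ft Fss Ftt -> (forall s t, continuity_2d_pt F s t) ->
  (forall s t, 0 <= t <= PI -> 0 <= F s t) ->
  (forall B, exists M, forall s t, s <= B -> 0 <= t <= PI -> Rabs (F s t) <= M) ->
  forall n s, moment F n s = moment F n 0.
Proof.
  intros HF HC Hpos Hbd. assert (P := PI_RGT_0).
  assert (bd : forall B, exists M, forall s, s <= B -> Rabs (moment F 0 s) <= M).
  { intros B. destruct (Hbd B) as [M HM]. exists ((PI - 0) * M). intros s Hs.
    apply abs_RInt_le_const; [lra | apply ex_RInt_moment; [lra | exact HC] |].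
    intros t Ht. replace M with (M * (1 * 1)) by ring.
    apply Rabs_mult_le; [now apply HM|]. apply Rabs_mult_le; [|apply Rabs_cos_pow_le1].
    rewrite <- RPow_abs, <- (pow1 3). apply pow_incr. split; [apply Rabs_pos|].
    apply Rabs_le. assert (H := SIN_bound t). lra. }
  assert (H0 : forall s, moment F 0 s = moment F 0 0).
  { intros s. apply approx_solution0_const; auto.
    replace 0 with (INR 0 * (INR 0 + 3)) at 1 by (simpl; ring).
    eapply moment_approx_solution; eauto. intros; simpl; ring. }
  assert (dom : forall n s, Rabs (moment F n s) <= moment F 0 0).
  { intros n s. rewrite <- (H0 s).
    eapply Rle_trans; [apply abs_RInt_le; [lra | apply ex_RInt_moment; [lra | exact HC]]|].
    apply RInt_le; [lra | | apply ex_RInt_moment; [lra | exact HC] |].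
    - apply (ex_RInt_norm (fun t => F s t * (sin t ^ 3 * cos t ^ n))).
      apply ex_RInt_moment; [lra | exact HC].
    - intros t Ht.
      assert (0 <= F s t) by (apply Hpos; lra).
      assert (0 <= sin t ^ 3) by (apply pow_le, sin_ge_0; lra).
      rewrite !Rabs_mult, (Rabs_pos_eq (F s t)), (Rabs_pos_eq (sin t ^ 3)) by assumption.
      apply Rmult_le_compat_l; [assumption|]. apply Rmult_le_compat_l; [assumption|].
      apply Rabs_cos_pow_le1. }
  (* Strong induction, since the source involves order [n - 2]. For [n = 1] the truncated [n - 2] is
     0, still below [n], and its coefficient is 0. *)
  induction n as [n IH] using (well_founded_induction Wf_nat.lt_wf).
  destruct (PeanoNat.Nat.eq_dec n 0) as [->|Hn]; [exact H0|].
  assert (n0 : 0 < INR n) by (apply lt_0_INR; lia).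
  assert (A : approx_solution (INR n * (INR n + 3))
    (- (INR n * INR (n - 1) * moment F (n - 2) 0)) (moment F n)).
  { eapply moment_approx_solution; eauto. intros s. rewrite IH by lia. ring. }
  intros s. rewrite (approx_solution_bounded _ _ _ _ n0 A (dom n) s).
  now rewrite (approx_solution_bounded _ _ _ _ n0 A (dom n) 0).
Qed.

(** The difference of two angular profiles times [sin^3] has all cosine moments zero; [sin^3 > 0]
    can then be divided out. *)
Lemma polar_solution_radially_const (F Fs Ft Fss Ftt : R -> R -> R) :
  polar_solution F Fs Ft Fss Ftt -> (forall s t, continuity_2d_pt F s t) ->
  (forall s t, 0 <= t <= PI -> 0 <= F s t) ->
  (forall B, exists M, forall s t, s <= B -> 0 <= t <= PI -> Rabs (F s t) <= M) ->
  forall s s' t, 0 < t < PI -> F s t = F s' t.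
Proof.
  intros HF HC Hpos Hbd s s' t Ht. assert (P := PI_RGT_0).
  assert (Hm := moment_const F Fs Ft Fss Ftt HF HC Hpos Hbd).
  assert (Z : (F s t - F s' t) * sin t ^ 3 = 0).
  { apply (cos_moments_vanish (fun t => (F s t - F s' t) * sin t ^ 3)); auto.
    - intros u. apply continuity_pt_mult; [|apply continuity_pt_sin_pow].
      apply continuity_pt_minus; now apply continuity_2d_pt_slice.
    - intros n. apply (is_RInt_unique (V := R_CompleteNormedModule)).
      assert (I : forall s, is_RInt (fun t => F s t * (sin t ^ 3 * cos t ^ n)) 0 PI
        (moment F n 0)).
      { intros z. rewrite <- (Hm n z). apply (RInt_correct (V := R_CompleteNormedModule)).
        apply ex_RInt_moment; [lra | exact HC]. }
      assert (L := is_RInt_minus _ _ _ _ _ _ (I s) (I s')).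
      unfold minus, plus, opp in L. simpl in L. rewrite Rplus_opp_r in L.
      revert L. apply is_RInt_ext. intros u _. simpl. ring. }
  assert (0 < sin t ^ 3) by (apply pow_lt, sin_gt_0; lra).
  apply Rmult_integral in Z. lra.
Qed.

(** * Passage from the half-plane to polar coordinates *)

Lemma continuity_2d_pt_comp_in (D : R -> R -> Prop) (g X Y : R -> R -> R) (s t : R) :
  cont_at_in D g (X s t) (Y s t) ->
  continuity_2d_pt X s t -> continuity_2d_pt Y s t ->
  locally_2d (fun u v => D (X u v) (Y u v)) s t ->
  continuity_2d_pt (fun u v => g (X u v) (Y u v)) s t.
Proof.
  intros Hg HX HY HD eps.
  destruct (Hg eps (cond_pos eps)) as [d [Hd Hg']].
  generalize (locally_2d_and _ _ _ _ HD
    (locally_2d_and _ _ _ _ (HX (mkposreal d Hd)) (HY (mkposreal d Hd)))).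
  apply locally_2d_impl, locally_2d_forall. intros u v [H1 [H2 H3]].
  now apply Hg'.
Qed.

Lemma H2_open (x y : R) : H2 x y -> locally_2d (fun u v => H2 u v) x y.
Proof.
  intros Hx. exists (mkposreal x Hx). simpl. intros u v Hu _.
  apply Rabs_def2 in Hu. unfold H2. lra.
Qed.

Lemma C0_H2_continuity_2d (g : R -> R -> R) (x y : R) :
  C0_on H2 g -> H2 x y -> continuity_2d_pt g x y.
Proof.
  intros Hg Hx. apply (continuity_2d_pt_comp_in H2 g (fun u _ => u) (fun _ v => v)).
  - now apply Hg.
  - apply continuity_2d_pt_id1.
  - apply continuity_2d_pt_id2.
  - now apply H2_open.
Qed.

(** One partial derivative continuous near the point and the other existing at the point give total
    differentiability, which the chain rule in polar coordinates requires. *)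
Lemma C1_H2_differentiable (g gx gy : R -> R -> R) (x y : R) :
  (forall x y, H2 x y -> is_dx g x y (gx x y) /\ is_dy g x y (gy x y)) ->
  C0_on H2 gx -> H2 x y -> differentiable_pt_lim g x y (gx x y) (gy x y).
Proof.
  intros Hg Hgx Hx. apply filterdiff_differentiable_pt_lim.
  apply (is_derive_filterdiff g x y gx (gy x y)).
  - apply -> (locally_2d_locally (fun u v => is_derive (fun z => g z v) u (gx u v)) x y).
    generalize (H2_open x y Hx). apply locally_2d_impl, locally_2d_forall.
    intros u v Hu. apply is_derive_Reals, Hg, Hu.
  - apply is_derive_Reals, Hg, Hx.
  - apply (continuity_2d_pt_filterlim gx x y). now apply C0_H2_continuity_2d.
Qed.

(** The angle is measured from the positive [y]-axis, so the half-plane is [0 < t < PI] and its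
    boundary lies at [t = 0] and [t = PI]. *)
Definition polx (s t : R) := exp s * sin t.
Definition poly (s t : R) := exp s * cos t.

Lemma continuity_2d_polx (s t : R) : continuity_2d_pt polx s t.
Proof.
  apply continuity_2d_pt_mult.
  - apply (continuity_1d_2d_pt_comp exp (fun u _ => u)); [|apply continuity_2d_pt_id1].
    apply derivable_continuous_pt, derivable_pt_exp.
  - apply (continuity_1d_2d_pt_comp sin (fun _ v => v)); [|apply continuity_2d_pt_id2].
    apply continuity_sin.
Qed.

Lemma continuity_2d_poly (s t : R) : continuity_2d_pt poly s t.
Proof.
  apply continuity_2d_pt_mult.
  - apply (continuity_1d_2d_pt_comp exp (fun u _ => u)); [|apply continuity_2d_pt_id1].
    apply derivable_continuous_pt, derivable_pt_exp.
  - apply (continuity_1d_2d_pt_comp cos (fun _ v => v)); [|apply continuity_2d_pt_id2].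
    apply continuity_cos.
Qed.

Lemma polx_pos (s t : R) : 0 < t < PI -> 0 < polx s t.
Proof.
  intros Ht. apply Rmult_lt_0_compat; [apply exp_pos | apply sin_gt_0; lra].
Qed.

Lemma continuity_2d_polar (g : R -> R -> R) (s t : R) :
  C0_on H2 g -> 0 < t < PI ->
  continuity_2d_pt (fun s t => g (polx s t) (poly s t)) s t.
Proof.
  intros Hg Ht. assert (X := polx_pos s t Ht).
  apply (continuity_2d_pt_comp_in H2).
  - now apply Hg.
  - apply continuity_2d_polx.
  - apply continuity_2d_poly.
  - generalize (continuity_2d_polx s t (mkposreal _ X)). simpl.
    apply locally_2d_impl, locally_2d_forall. intros u v Hu.
    apply Rabs_def2 in Hu. unfold H2. lra.
Qed.

Lemma is_derive_polar_s (g : R -> R -> R) (s t gx gy : R) :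
  differentiable_pt_lim g (polx s t) (poly s t) gx gy ->
  is_derive (fun z => g (polx z t) (poly z t)) s (polx s t * gx + poly s t * gy).
Proof.
  intros Hg. apply is_derive_Reals. rewrite !(Rmult_comm _ gx), !(Rmult_comm _ gy).
  apply derivable_pt_lim_comp_2d; [exact Hg | |]; apply is_derive_Reals;
    unfold polx, poly; auto_derive; auto; ring.
Qed.

Lemma is_derive_polar_t (g : R -> R -> R) (s t gx gy : R) :
  differentiable_pt_lim g (polx s t) (poly s t) gx gy ->
  is_derive (fun z => g (polx s z) (poly s z)) t (poly s t * gx - polx s t * gy).
Proof.
  intros Hg. apply is_derive_Reals.
  replace (_ - _) with (gx * poly s t + gy * (- polx s t)) by ring.
  apply derivable_pt_lim_comp_2d; [exact Hg | |]; apply is_derive_Reals;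
    unfold polx, poly; auto_derive; auto; ring.
Qed.

(** Reflection in [x = 0] turns continuity relative to the closed half-plane into continuity on the
    whole plane, the form that the integration lemmas use. *)
Lemma C0_H2bar_even_extension (f : R -> R -> R) (x y : R) :
  C0_on H2bar f -> continuity_2d_pt (fun x y => f (Rabs x) y) x y.
Proof.
  intros Hf. apply (continuity_2d_pt_comp_in H2bar f (fun u _ => Rabs u) (fun _ v => v)).
  - apply Hf. apply Rabs_pos.
  - apply (continuity_1d_2d_pt_comp Rabs (fun u _ => u));
      [apply Rcontinuity_abs | apply continuity_2d_pt_id1].
  - apply continuity_2d_pt_id2.
  - apply locally_2d_forall. intros. apply Rabs_pos.
Qed.

Lemma continuity_2d_polar_even (f : R -> R -> R) (s t : R) :
  C0_on H2bar f -> continuity_2d_pt (fun s t => f (Rabs (polx s t)) (poly s t)) s t.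
Proof.
  intros Hf. apply (continuity_2d_pt_comp_in H2bar f (fun u v => Rabs (polx u v)) poly).
  - apply Hf, Rabs_pos.
  - apply (continuity_1d_2d_pt_comp Rabs polx); [apply Rcontinuity_abs|].
    apply continuity_2d_polx.
  - apply continuity_2d_poly.
  - apply locally_2d_forall. intros. apply Rabs_pos.
Qed.

(** All [s <= B] map into the square of half-side [exp B], a compact set containing the origin;
    continuity up to the origin thus gives the bound at [-oo]. *)
Lemma polar_even_bounded (f : R -> R -> R) (B : R) :
  C0_on H2bar f ->
  exists M, forall s t, s <= B -> Rabs (f (Rabs (polx s t)) (poly s t)) <= M.
Proof.
  intros Hf. assert (E := exp_pos B).
  destruct (continuity_2d_bounded (fun x y => f (Rabs x) y) (- exp B) (exp B)
    (- exp B) (exp B) ltac:(lra) ltac:(lra)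
    (fun x y => C0_H2bar_even_extension f x y Hf)) as [M HM].
  exists M. intros s t Hs. apply (HM (polx s t) (poly s t)).
  all: apply Rabs_le_between; unfold polx, poly; rewrite <- (Rmult_1_r (exp B));
    apply Rabs_mult_le; [rewrite Rabs_pos_eq by (left; apply exp_pos);
      destruct Hs as [Hs | ->]; [left; now apply exp_increasing | lra] |
    apply Rabs_le; assert (H := SIN_bound t); assert (H' := COS_bound t); lra].
Qed.

Lemma locally_between_0_PI (t : R) : 0 < t < PI ->
  locally t (fun z => 0 < z < PI).
Proof.
  intros Ht. assert (Hm : 0 < Rmin t (PI - t)) by (apply Rmin_pos; lra).
  exists (mkposreal _ Hm). intros z Hz. apply Rabs_def2 in Hz. simpl in Hz.
  unfold minus, plus, opp in Hz. simpl in Hz.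
  assert (H1 := Rmin_l t (PI - t)). assert (H2 := Rmin_r t (PI - t)). lra.
Qed.

(** The chain rule gives [F_ss + 3 F_s + F_tt + 3 cot t F_t = e^(2 s) (f_xx + f_yy + (3 / x) f_x)]:
    the mixed derivatives enter [F_ss] and [F_tt] with opposite signs, and the [f_y] terms cancel
    through [cot t = y / x]. *)
Lemma polar_solution_of_C2 (f fx fy fxx fxy fyx fyy : R -> R -> R) :
  (forall x y, H2 x y -> is_dx f x y (fx x y) /\ is_dy f x y (fy x y)) ->
  (forall x y, H2 x y -> is_dx fx x y (fxx x y) /\ is_dy fx x y (fxy x y)) ->
  (forall x y, H2 x y -> is_dx fy x y (fyx x y) /\ is_dy fy x y (fyy x y)) ->
  C0_on H2 f -> C0_on H2 fx -> C0_on H2 fy ->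
  C0_on H2 fxx -> C0_on H2 fxy -> C0_on H2 fyx -> C0_on H2 fyy ->
  (forall x y, H2 x y -> fxx x y + fyy x y + 3 / x * fx x y = 0) ->
  exists Fs Ft Fss Ftt,
    polar_solution (fun s t => f (Rabs (polx s t)) (poly s t)) Fs Ft Fss Ftt.
Proof.
  intros D Dx Dy C Cx Cy Cxx Cxy Cyx Cyy E.
  exists (fun s t => polx s t * fx (polx s t) (poly s t)
    + poly s t * fy (polx s t) (poly s t)).
  exists (fun s t => poly s t * fx (polx s t) (poly s t)
    - polx s t * fy (polx s t) (poly s t)).
  exists (fun s t => polx s t * fx (polx s t) (poly s t)
    + poly s t * fy (polx s t) (poly s t)
    + polx s t * (polx s t * fxx (polx s t) (poly s t) + poly s t * fxy (polx s t) (poly s t))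
    + poly s t * (polx s t * fyx (polx s t) (poly s t) + poly s t * fyy (polx s t) (poly s t))).
  exists (fun s t => - polx s t * fx (polx s t) (poly s t)
    - poly s t * fy (polx s t) (poly s t)
    + poly s t * (poly s t * fxx (polx s t) (poly s t) - polx s t * fxy (polx s t) (poly s t))
    - polx s t * (poly s t * fyx (polx s t) (poly s t) - polx s t * fyy (polx s t) (poly s t))).
  intros s t Ht. assert (X := polx_pos s t Ht).
  assert (Q := C1_H2_differentiable f fx fy _ (poly s t) D Cx X).
  assert (Qx := C1_H2_differentiable fx fxx fxy _ (poly s t) Dx Cxx X).
  assert (Qy := C1_H2_differentiable fy fyx fyy _ (poly s t) Dy Cyx X).
  assert (es : forall z, 0 < z < PI -> forall s, Rabs (polx s z) = polx s z).
  { intros z Hz r. apply Rabs_pos_eq. left. now apply polx_pos. }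
  assert (KX := continuity_2d_polx). assert (KY := continuity_2d_poly).
  assert (K := fun g Cg => continuity_2d_polar g s t Cg Ht).
  split; [|split; [|split; [|split; [|split; [|split; [|split; [|split]]]]]]].
  - apply (is_derive_ext (fun z => f (polx z t) (poly z t))).
    + intros z. now rewrite es.
    + now apply is_derive_polar_s.
  - assert (D1 := is_derive_polar_s fx s t _ _ Qx).
    assert (D2 := is_derive_polar_s fy s t _ _ Qy).
    evar_last.
    + apply (is_derive_plus (fun z => polx z t * fx (polx z t) (poly z t))
        (fun z => poly z t * fy (polx z t) (poly z t))).
      * apply (is_derive_mult (fun z => polx z t)); [|exact D1 | exact Rmult_comm].
        unfold polx. auto_derive; [exact I | reflexivity].
      * apply (is_derive_mult (fun z => poly z t)); [|exact D2 | exact Rmult_comm].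
        unfold poly. auto_derive; [exact I | reflexivity].
    + unfold plus, mult. simpl. unfold polx, poly. ring.
  - apply (is_derive_ext_loc (fun z => f (polx s z) (poly s z))).
    + generalize (locally_between_0_PI t Ht). apply filter_imp.
      intros z Hz. now rewrite es.
    + now apply is_derive_polar_t.
  - assert (D1 := is_derive_polar_t fx s t _ _ Qx).
    assert (D2 := is_derive_polar_t fy s t _ _ Qy).
    evar_last.
    + apply (is_derive_minus (fun z => poly s z * fx (polx s z) (poly s z))
        (fun z => polx s z * fy (polx s z) (poly s z))).
      * apply (is_derive_mult (fun z => poly s z)); [|exact D1 | exact Rmult_comm].
        unfold poly. auto_derive; [exact I | reflexivity].
      * apply (is_derive_mult (fun z => polx s z)); [|exact D2 | exact Rmult_comm].
        unfold polx. auto_derive; [exact I | reflexivity].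
    + unfold minus, plus, opp, mult. simpl. unfold polx, poly. ring.
  - apply continuity_2d_pt_ext_loc with (fun s t => f (polx s t) (poly s t)); [|now apply K].
    destruct (locally_between_0_PI t Ht) as [d Hd]. exists d. intros u v _ Hv.
    rewrite es; [reflexivity|]. now apply Hd.
  - repeat first [apply KX | apply KY | now apply K
      | apply continuity_2d_pt_plus | apply continuity_2d_pt_mult].
  - repeat first [apply KX | apply KY | now apply K
      | apply continuity_2d_pt_plus | apply continuity_2d_pt_mult].
  - repeat first [apply KX | apply KY | now apply K
      | apply continuity_2d_pt_minus | apply continuity_2d_pt_plus
      | apply continuity_2d_pt_mult | apply continuity_2d_pt_opp].
  - specialize (E _ (poly s t) X).
    assert (Sc : cos t * polx s t = sin t * poly s t) by (unfold polx, poly; ring).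
    assert (Fxx : fxx (polx s t) (poly s t) = - fyy (polx s t) (poly s t)
      - 3 / polx s t * fx (polx s t) (poly s t)) by lra.
    cbv beta. rewrite Fxx.
    replace (cos t) with (sin t * poly s t / polx s t) by (rewrite <- Sc; field; lra).
    field. lra.
Qed.
Lemma polar_coordinates (x y : R) :
  0 < x -> exists s t, 0 < t < PI /\ polx s t = x /\ poly s t = y.
Proof.
  intros Hx. set (a := atan (y / x)). assert (B := atan_bound (y / x)). fold a in B.
  assert (ca : 0 < cos a) by (apply cos_gt_0; lra).
  (* With [a] the angle from the positive [x]-axis, [x / cos a] is the distance to the origin. *)
  exists (ln (x / cos a)), (PI / 2 - a). split; [lra|].
  unfold polx, poly. rewrite exp_ln by (apply Rdiv_lt_0_compat; lra).
  rewrite sin_shift, cos_shift. split; [field; lra|].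
  assert (T : sin a / cos a = y / x) by exact (tan_atan (y / x)).
  replace (x / cos a * sin a) with (x * (sin a / cos a)) by (field; lra).
  rewrite T. field. lra.
Qed.

Theorem theorem4p14 (f : R -> R -> R)
  (hC0 : C0_on H2bar f)
  (hCinf : Cinf_H2 f)
  (hpos : forall x y, H2bar x y -> 0 <= f x y)
  (hpde : exists fx fy fxx fyy : R -> R -> R,
     forall x y, H2 x y ->
       is_dx f x y (fx x y) /\ is_dy f x y (fy x y) /\
       is_dx fx x y (fxx x y) /\ is_dy fy x y (fyy x y) /\
       fxx x y + fyy x y + 3 / x * fx x y = 0) :
  exists c : R, forall x y, H2bar x y -> f x y = c.
Proof.
  destruct hpde as [ux [uy [uxx [uyy hu]]]].
  destruct (hCinf 2%nat) as [C [fx [fy [D [[Cx [fxx [fxy [Dx [Cxx Cxy]]]]]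
    [Cy [fyx [fyy [Dy [Cyx Cyy]]]]]]]]]].
  destruct Cxx as [Cxx _]. destruct Cxy as [Cxy _].
  destruct Cyx as [Cyx _]. destruct Cyy as [Cyy _].
  (* The derivatives in the equation and those witnessing the C^2 property are given separately;
     uniqueness of limits identifies them on the open half-plane. *)
  assert (ex : forall x y, H2 x y -> ux x y = fx x y).
  { intros x y Hx. eapply uniqueness_limite; [apply (hu x y Hx) | apply (D x y Hx)]. }
  assert (ey : forall x y, H2 x y -> uy x y = fy x y).
  { intros x y Hx. eapply uniqueness_limite; [apply (hu x y Hx) | apply (D x y Hx)]. }
  assert (exx : forall x y, H2 x y -> uxx x y = fxx x y).
  (* [ux] and [fx] agree only for positive abscissa, so along a horizontal line the identification
     is local; vertical lines stay inside the half-plane. *)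
  { intros x y Hx. apply uniqueness_limite with (fun t => fx t y) x; [|now apply Dx].
    apply is_derive_Reals, is_derive_ext_loc with (fun t => ux t y).
    - apply locally_2d_1d_const_y with (P := fun u v => ux u v = fx u v).
      generalize (H2_open x y Hx). apply locally_2d_impl, locally_2d_forall. exact ex.
    - apply is_derive_Reals, (hu x y Hx). }
  assert (eyy : forall x y, H2 x y -> uyy x y = fyy x y).
  { intros x y Hx. apply uniqueness_limite with (fun t => fy x t) y; [|now apply Dy].
    apply is_derive_Reals, is_derive_ext with (fun t => uy x t).
    - intros t. now apply ey.
    - apply is_derive_Reals, (hu x y Hx). }
  destruct (polar_solution_of_C2 f fx fy fxx fxy fyx fyy D Dx Dy C Cx Cy Cxx Cxy Cyx Cyy)
    as [Fs [Ft [Fss [Ftt HF]]]].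
  { intros x y Hx. rewrite <- ex, <- exx, <- eyy by assumption. now apply hu. }
  assert (H := polar_solution_radially_const _ _ _ _ _ HF
    (fun s t => continuity_2d_polar_even f s t hC0)
    (fun s t _ => hpos _ _ (Rabs_pos _))).
  assert (rad : forall s s' t, 0 < t < PI ->
    f (polx s t) (poly s t) = f (polx s' t) (poly s' t)).
  { intros s s' t Ht.
    rewrite <- (Rabs_pos_eq (polx s t)), <- (Rabs_pos_eq (polx s' t))
      by (left; now apply polx_pos).
    apply H; [|exact Ht]. intros B.
    destruct (polar_even_bounded f B hC0) as [M HM]. exists M. auto. }
  assert (inner : forall x y, 0 < x -> f x y = f 0 0).
  { intros x y Hx. destruct (polar_coordinates x y Hx) as [s [t [Ht [<- <-]]]].
    apply cond_eq. intros e He.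
    destruct (hC0 0 0 (Rle_refl 0) e He) as [d [Hd Hc]].
    (* Slide along the ray to radius [d / 2], inside the neighbourhood given by continuity at the
       origin. *)
    rewrite (rad s (ln (d / 2)) t Ht).
    assert (E : exp (ln (d / 2)) = d / 2) by (apply exp_ln; lra).
    apply Hc.
    - left. now apply polx_pos.
    - unfold polx. rewrite Rminus_0_r, E. apply Rle_lt_trans with (d / 2 * 1); [|lra].
      apply Rabs_mult_le; [rewrite Rabs_pos_eq; lra|].
      apply Rabs_le, SIN_bound.
    - unfold poly. rewrite Rminus_0_r, E. apply Rle_lt_trans with (d / 2 * 1); [|lra].
      apply Rabs_mult_le; [rewrite Rabs_pos_eq; lra|].
      apply Rabs_le, COS_bound. }
  exists (f 0 0). intros x y [Hx | <-]; [now apply inner|].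
  apply cond_eq. intros e He.
  destruct (hC0 0 y (Rle_refl 0) e He) as [d [Hd Hc]].
  (* Boundary points are reached by continuity, from the interior point [(d / 2, y)]. *)
  rewrite Rabs_minus_sym, <- (inner (d / 2) y) by lra.
  apply Hc.
  - unfold H2bar. lra.
  - rewrite Rminus_0_r, Rabs_pos_eq; lra.
  - rewrite Rminus_diag, Rabs_R0. exact Hd.
Qed.
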